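(* Let $X_i=\theta_i+\varepsilon_i$, $i=1,\dots,n$, with $\varepsilon_i$ i.i.d. $N(0,1)$. Assume that as $n\to\infty$, $s_n\to\infty$, $n/s_n\to\infty$, $\alpha_n\to0$ and $\log(1/\alpha_n)=o\{\sqrt{\log(n/s_n)}\}$. Fix a heterogeneous signal-strength vector $a=(a_1,\dots,a_{s_n})$ of positive numbers (for each $n$). Then the GBS procedure $\varphi^{\mathrm{GBS}}$ at nominal level $\alpha_n$ satisfies $$\sup_{\theta\in\Theta(a,s_n)}\mathbb E_\theta\{\mathrm{FDP}(\theta,\varphi^{\mathrm{GBS}})+\mathrm{FNP}(\theta,\varphi^{\mathrm{GBS}})\}\le\Lambda_n(a)+o(1).$$ Consequently, the GBS procedure is sharply asymptotically minimax under the combined $\mathrm{FDP}+\mathrm{FNP}$ loss over $\Theta(a,s_n)$, i.e. $$\sup_{\theta\in\Theta(a,s_n)}\mathbb E_\theta\{\mathrm{FDP}(\theta,\varphi^{\mathrm{GBS}})+\mathrm{FNP}(\theta,\varphi^{\mathrm{GBS}})\}=\mathcal R_F(\Theta(a,s_n))+o(1).$$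
   Context: Here $(s_n)$ is a sequence of positive integers with $s_n\le n$ and $\alpha_n\in(0,1)$. The vector $a$ may depend on $n$. $\Phi$ is the standard normal distribution function and $\bar\Phi=1-\Phi$. For $\theta\in\mathbb R^n$, $S_\theta=\{i:\theta_i\ne0\}$. Define $$\Theta(a,s_n)=\{\theta\in\mathbb R^n:|S_\theta|=s_n,\ \text{there exist distinct } i_1,\dots,i_{s_n}\text{ such that }|\theta_{i_j}|\ge a_j,\ 1\le j\le s_n\},$$ $$a_n^*=\sqrt{2\log(n/s_n)},\qquad \Lambda_n(a)=\frac1{s_n}\sum_{j=1}^{s_n}\bar\Phi(a_j-a_n^* ).$$ One tests $H_{0i}:\theta_i=0$ versus $H_{1i}:\theta_i\ne0$. A multiple testing procedure is a (measurable) function $\varphi=(\varphi_1,\dots,\varphi_n)\in\{0,1\}^n$ of the data $X=(X_1,\dots,X_n)$, with $\varphi_i=1$ meaning that $H_{0i}$ is rejected. Put $V(\theta,\varphi)=\sum_{i:\theta_i=0}\varphi_i$, $T(\theta,\varphi)=\sum_{i:\theta_i\ne0}(1-\varphi_i)$, $$\mathrm{FDP}(\theta,\varphi)=\frac{V(\theta,\varphi)}{\max\{1,\sum_{i=1}^n\varphi_i\}},\qquad \mathrm{FNP}(\theta,\varphi)=\frac{T(\theta,\varphi)}{\max\{1,s_n\}},$$ and $\mathcal R_F(\Theta)=\inf_\varphi\sup_{\theta\in\Theta}\mathbb E_\theta\{\mathrm{FDP}(\theta,\varphi)+\mathrm{FNP}(\theta,\varphi)\}$, the infimum being over all multiple testing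 procedures. Sharp asymptotic minimaxity of a procedure means that its maximal risk over the class equals the minimax risk up to $o(1)$. GBS (Gavrilov--Benjamini--Sarkar) step-down procedure: let $P_i=2\bar\Phi(|X_i|)$, with ordered values $P_{(1)}\le\dots\le P_{(n)}$, and $c_j=\dfrac{j\alpha_n}{n+1-j(1-\alpha_n)}$, $j=1,\dots,n$. Let $R_n^{\mathrm{GBS}}=\max\{r:P_{(j)}\le c_j\text{ for every }1\le j\le r\}$ ($=0$ if the set is empty). $\varphi^{\mathrm{GBS}}$ rejects exactly the hypotheses corresponding to $P_{(1)},\dots,P_{(R_n^{\mathrm{GBS}})}$. *)

(* Defs.v *)
From mathcomp Require Export all_boot all_order all_algebra.
From mathcomp Require Export all_classical all_reals all_analysis.

Set Implicit Arguments.
Unset Strict Implicit.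
Unset Printing Implicit Defensive.

Import Order.TTheory GRing.Theory Num.Theory.
Import numFieldNormedType.Exports.

Local Open Scope classical_set_scope.
Local Open Scope ring_scope.

Section Gaussian.
Context {R : realType}.

Definition Phi (x : R) : R := fine (normal_prob 0 1 `]-oo, x]).

Definition Phibar (x : R) : R := 1 - Phi x.

Definition mutually_independent d (T : measurableType d) (P : probability T R)
    n (X : 'I_n -> {RV P >-> R}) : Prop :=
  forall (J : {set 'I_n}) (B : 'I_n -> set R), (forall i, measurable (B i)) ->
    P (\bigcap_(i in [set` J]) (X i @^-1` B i)) =
    (\prod_(i in J) P (X i @^-1` B i))%E.

Definition iid_std_normal d (T : measurableType d) (P : probability T R)
    n (eps : 'I_n -> {RV P >-> R}) : Prop :=
  mutually_independent eps /\
  forall i (A : set R), measurable A ->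
    distribution P (eps i) A = normal_prob 0 1 A.

End Gaussian.

Section SignalClass.
Context {R : realType}.

Definition support_set n (theta : n.-tuple R) : {set 'I_n} :=
  [set i | tnth theta i != 0].

Definition signal_class n s (a : 'I_s -> R) : set (n.-tuple R) :=
  [set theta | #|support_set theta| = s /\
    exists i : 'I_s -> 'I_n,
      injective i /\ forall j, a j <= `|tnth theta (i j)|].

Definition astar (n s : nat) : R := Num.sqrt (2 * ln (n%:R / s%:R)).

Definition Lambda (n s : nat) (a : 'I_s -> R) : R :=
  s%:R^-1 * \sum_(j < s) Phibar (a j - astar n s).

End SignalClass.

Section Loss.
Context {R : realType}.
Variable n : nat.
Implicit Types (theta : n.-tuple R) (phi : n.-tuple bool).

Definition false_rejections theta phi : nat :=
  (\sum_(i < n | tnth theta i == 0%R) tnth phi i)%N.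

Definition missed_signals theta phi : nat :=
  (\sum_(i < n | tnth theta i != 0%R) (1 - tnth phi i))%N.

Definition FDP theta phi : R :=
  (false_rejections theta phi)%:R / (maxn 1 (\sum_(i < n) tnth phi i)%N)%:R.

Definition FNP (s : nat) theta phi : R :=
  (missed_signals theta phi)%:R / (maxn 1 s)%:R.

End Loss.

Section Risk.
Context {R : realType} {d : measure_display} {T : measurableType d}.
Variables (P : probability T R) (n : nat) (eps : 'I_n -> {RV P >-> R}).

Definition observation (theta : n.-tuple R) (w : T) : n.-tuple R :=
  [tuple tnth theta i + eps i w | i < n].

Definition risk (s : nat) (phi : n.-tuple R -> n.-tuple bool)
    (theta : n.-tuple R) : \bar R :=
  ('E_P[fun w => (FDP theta (phi (observation theta w)) +
                  FNP s theta (phi (observation theta w)))%R])%E.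

Definition max_risk (s : nat) (a : 'I_s -> R)
    (phi : n.-tuple R -> n.-tuple bool) : \bar R :=
  ereal_sup [set risk s phi theta | theta in signal_class (n := n) a].

Definition minimax_risk (s : nat) (a : 'I_s -> R) : \bar R :=
  ereal_inf [set max_risk a phi |
    phi in [set phi : n.-tuple R -> n.-tuple bool | measurable_fun setT phi]].

End Risk.

Section GBS.
Context {R : realType}.
Variables (n : nat) (alpha : R).
Implicit Types x : n.-tuple R.

Definition pvalue x (i : 'I_n) : R := 2 * Phibar `|tnth x i|.

Definition sorted_pvalues x : seq R := sort <=%R [seq pvalue x i | i : 'I_n].

(* [P_(j)] for [1 <= j <= n]; the list is indexed from 0. *)
Definition ordered_pvalue x (j : nat) : R := nth 0 (sorted_pvalues x) j.-1.

Definition gbs_threshold (j : nat) : R :=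
  j%:R * alpha / (n.+1%:R - j%:R * (1 - alpha)).

Definition gbs_count x : nat :=
  \max_(r < n.+1 |
    all (fun j => ordered_pvalue x j <= gbs_threshold j) (iota 1 r)) r.

(* Ties do not matter: for [0 < alpha < 1] the thresholds increase with [j],
   so [P_(r+1) = P_(r) <= c_r] would contradict the maximality of [r];
   hence exactly [gbs_count x] hypotheses are rejected. *)
Definition gbs x : n.-tuple bool :=
  [tuple pvalue x i \in take (gbs_count x) (sorted_pvalues x) | i < n].

End GBS.

(* Main.v *)
Require Import Defs.
From mathcomp Require Import all_boot all_order all_algebra.
From mathcomp Require Import all_classical all_reals all_analysis.
From mathcomp Require Import measurable_realfun ring lra zify.

Set Implicit Arguments.
Unset Strict Implicit.
Unset Printing Implicit Defensive.

Import Order.TTheory GRing.Theory Num.Theory.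
Import numFieldNormedType.Exports.

Local Open Scope classical_set_scope.
Local Open Scope ring_scope.

(** Both the step-down procedure and the best possible procedure reject, in
    effect, the observations beyond the boundary [astar n s], up to [o(1)]; a
    signal of strength [a j] is then missed with probability
    [Phibar (a j - astar n s)], and the average of these numbers is [Lambda].

    False discoveries. If hypothesis [i] is rejected, lowering its p-value does
    not change the number of steps ([gbs_count_upd]). Conditionally on the other
    observations, a null [i] thus contributes to the expected proportion at most
    [thr r / r] for a fixed [r], which is at most [2 * alpha / n.+1] as long as
    [r] is below half of [n] ([rejection_share_bound]). More rejections require
    many null p-values below [alpha], which is unlikely by Markov's inequality.
    The total is at most [6 * alpha] ([Ex_FDP_gbs]).

    Missed signals. If [Lambda > 1 - delta], even missing everything is
    acceptable. Otherwise a proportion [delta / 2] of the signals exceeds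
    [astar n s - C], and for every step [j] up to a small multiple of [s] the
    expected number of signal p-values below [thr j] is a large multiple of [j]:
    this is where [ln (1 / alpha)] must be negligible against [astar n s].
    Chebyshev's inequality along the powers of two then shows that, with
    probability close to one, the procedure makes a number of steps proportional
    to [s] ([gbs_count_lower_tail]). At such a step the critical value is
    [astar n s + o(1)] ([Ex_FNP_gbs_Lambda]).

    Lower bound. The signals are placed at independent uniform positions in [s]
    blocks of length [n %/ s]. A procedure with more than [K * s] rejections has
    false discovery proportion close to one, so that rejections may be assumed to
    number at most [K * s] ([loss_ge_linear]). Under this budget, detecting a
    signal below [astar n s - eta] is bounded by comparing the law of the block
    with its null version through truncated likelihood ratios
    ([block_detection_bound]). Averaging over the positions gives a parameter
    with risk at least [Lambda - o(1)] ([hard_theta_Lambda]).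

    All expectations are computed under the law of the noise on tuples. The only
    consequence of independence in use, beyond the pairwise one, is that a
    coordinate may be replaced by a fresh copy ([ge0_integral_resample]). *)

(** * Integration against a density *)

Section Density.
Context d (T : measurableType d) (R : realType).
Variables (mu nu : {measure set T -> \bar R}) (h : T -> R).
Hypothesis mh : measurable_fun setT h.
Hypothesis h0 : forall x, 0 <= h x.
Hypothesis nuE : forall A, measurable A -> nu A = (\int[mu]_(x in A) (h x)%:E)%E.

Import HBNNSimple.

(** The identity holds on indicators by assumption, hence on simple functions,
    and passes to the limit by monotone convergence. *)
Lemma ge0_integral_density (f : T -> \bar R) :
  measurable_fun setT f -> (forall x, 0 <= f x)%E ->
  (\int[nu]_x f x = \int[mu]_x (f x * (h x)%:E))%E.
Proof.
move=> mf f0.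
have mhE : measurable_fun setT (EFin \o h) by exact/measurable_EFinP.
pose g := nnsfun_approx measurableT mf.
have -> : (\int[nu]_x f x = lim (\int[nu]_x (g n x)%:E @[n --> \oo]))%E.
  rewrite -monotone_convergence//=.
  - apply: eq_integral => x _; apply/esym/cvg_lim => //.
    exact: cvg_nnsfun_approx.
  - by move=> n; exact/measurable_EFinP.
  - by move=> n x _; rewrite lee_fin.
  - by move=> x _ m n mn; rewrite lee_fin; exact/lefP/nd_nnsfun_approx.
have -> : (\int[mu]_x (f x * (h x)%:E) =
    lim (\int[mu]_x ((g n x)%:E * (h x)%:E) @[n --> \oo]))%E.
  rewrite -monotone_convergence//=.
  - apply: eq_integral => x _; apply/esym/cvg_lim => //.
    by apply: cvgeZr => //; exact: cvg_nnsfun_approx.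
  - by move=> n; apply: emeasurable_funM => //; exact/measurable_EFinP.
  - by move=> n x _; rewrite mule_ge0// lee_fin.
  - move=> x _ m n mn; rewrite lee_wpmul2r ?lee_fin//.
    exact/lefP/nd_nnsfun_approx.
apply: congr_lim; apply/funext => n.
under eq_integral do rewrite fimfunE -fsumEFin//.
rewrite ge0_integral_fsum//; last 2 first.
  - by move=> r; exact/measurable_EFinP/measurableT_comp.
  - by move=> r x _; rewrite EFinM nnfun_muleindic_ge0.
transitivity (\int[mu]_x (\sum_(r \in range (g n))
    ((r * \1_(g n @^-1` [set r]) x)%:E * (h x)%:E)))%E; last first.
  apply: eq_integral => x _; rewrite fimfunE -fsumEFin// ge0_mule_fsuml// => r.
  exact: nnfun_muleindic_ge0.
rewrite ge0_integral_fsum//; last 2 first.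
  - move=> r; apply: emeasurable_funM => //.
    by apply/measurable_EFinP; apply: measurable_funM.
  - by move=> r x _; rewrite mule_ge0 ?lee_fin//; exact: nnfun_muleindic_ge0.
apply: eq_fsbigr => r _.
rewrite integralZl_indic_nnsfun// integral_indic//= setIT nuE//.
have [r0|r0] := leP 0 r; last first.
  rewrite preimage_nnfun0// integral_set0 mule0.
  by rewrite integral0_eq// => x _; rewrite indic0 mulr0 mul0e.
under [RHS]eq_integral do rewrite EFinM -muleA.
rewrite ge0_integralZl//; last 2 first.
  - by apply: emeasurable_funM => //; exact/measurable_EFinP.
  - by move=> x _; rewrite mule_ge0// lee_fin.
congr (_ * _)%E; rewrite integral_mkcond; apply: eq_integral => x _.
by rewrite patchE indicE; case: ifPn; rewrite (mul1e, mul0e).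
Qed.

End Density.

(** * The standard normal law *)

Section StandardNormal.
Context {R : realType}.
Implicit Types x y z a t c : R.
Notation N := (@normal_prob R 0 1).
Notation mu := (@lebesgue_measure R).
Notation g := (@normal_pdf R 0 1).

Lemma normal_pdf01 x : g x = normal_peak 1 * expR (- (x ^+ 2) / 2).
Proof. by rewrite normal_pdfE ?oner_neq0// /normal_fun subr0 expr1n. Qed.

Lemma normal_peak1_le1 : normal_peak (1 : R) <= 1.
Proof.
rewrite /normal_peak invf_le1 ?sqrtr_gt0.
  by rewrite -[leLHS]sqrtr1 ler_wsqrtr// expr1n mul1r; have := pi_ge2 R; lra.
by rewrite expr1n mul1r pmulrn_lgt0// pi_gt0.
Qed.

(** Lebesgue measure and its translate agree on half-open intervals. *)
Lemma ge0_integral_translate a (f : R -> \bar R) :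
  measurable_fun setT f -> (forall x, 0 <= f x)%E ->
  (\int[mu]_x f (x + a)%R = \int[mu]_x f x)%E.
Proof.
move=> mf f0.
have mT : measurable_fun setT
    (fun x : measurableTypeR R => (x + a : measurableTypeR R)).
  exact: measurable_funD.
pose h : {mfun measurableTypeR R >-> measurableTypeR R} := 
  @mfun_Sub _ _ (measurableTypeR R) (measurableTypeR R) _ (mem_set mT).
have E A : measurable A -> mu A = pushforward mu h A.
  move=> mA; have := @lebesgue_measure_unique R (pushforward mu h) _ A mA.
  apply => {A mA} _ [[x y] _ <-] /=; rewrite /pushforward.
  have -> : h @^-1` `]x, y] = `]x - a, y - a]%classic.
    by apply/seteqP; split => z /=; rewrite !in_itv/=; lra.
  rewrite !lebesgue_measure_itv/= !lte_fin ltrD2r -!EFinB; case: ifP => // _.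
  by congr (_%:E); ring.
rewrite -[LHS](@ge0_integral_pushforward _ _ (measurableTypeR R)
  (measurableTypeR R) R h mT mu setT f)//.
by apply: eq_measure_integral => A mA _; rewrite [RHS]E.
Qed.

Lemma ge0_integral_normal (f : R -> \bar R) :
  measurable_fun setT f -> (forall x, 0 <= f x)%E ->
  (\int[N]_x f x = \int[mu]_x (f x * (g x)%:E))%E.
Proof.
move=> mf f0; apply: ge0_integral_density => //.
- exact: measurable_normal_pdf.
- exact: normal_pdf_ge0.
Qed.

(** Completing the square turns a translation of a Gaussian variable into the
    likelihood ratio [expR (a * z - a ^+ 2 / 2)]. *)
Lemma normal_shift a (f : R -> \bar R) :
  measurable_fun setT f -> (forall x, 0 <= f x)%E ->
  (\int[N]_z f (z + a)%R = \int[N]_z (f z * (expR (a * z - a ^+ 2 / 2))%:E))%E.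
Proof.
move=> mf f0.
have mg := measurable_normal_pdf (0 : R) 1.
rewrite !ge0_integral_normal//.
- rewrite -(@ge0_integral_translate a (fun z => f z * _ * _)%E); last 2 first.
  + apply: emeasurable_funM; last exact/measurable_EFinP.
    apply: emeasurable_funM => //; apply/measurable_EFinP.
    by apply: measurableT_comp => //; apply: measurable_funB.
  + by move=> x; rewrite !mule_ge0// lee_fin ?expR_ge0 ?normal_pdf_ge0.
  apply: eq_integral => z _; rewrite -muleA -EFinM; congr (_ * _%:E)%E.
  rewrite !normal_pdf01 mulrCA -expRD; congr (_ * expR _).
  by field.
- apply: emeasurable_funM => //; apply/measurable_EFinP.
  by apply: measurableT_comp => //; apply: measurable_funB.
- by move=> x; rewrite mule_ge0// lee_fin expR_ge0.
- by apply: measurableT_comp => //; exact: measurable_funD.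
Qed.

End StandardNormal.

Section NormalTails.
Context {R : realType}.
Implicit Types x y z a t c : R.
Notation N := (@normal_prob R 0 1).
Notation mu := (@lebesgue_measure R).
Notation g := (@normal_pdf R 0 1).

Lemma EFin_Phi x : (Phi x)%:E = N `]-oo, x].
Proof. by rewrite /Phi fineK// fin_num_measure. Qed.

Lemma Phi_ge0 x : 0 <= Phi x.
Proof. by rewrite -lee_fin EFin_Phi. Qed.

Lemma Phi_le1 x : Phi x <= 1.
Proof. by rewrite -lee_fin EFin_Phi; exact: probability_le1. Qed.

Lemma normal_itv x y : x <= y -> N `]x, y] = (Phi y - Phi x)%:E.
Proof.
move=> xy; rewrite EFinB !EFin_Phi.
have -> : `]-oo, y]%classic = (`]-oo, x] `|` `]x, y] : set R).
  by apply/seteqP; split => z /=; rewrite !in_itv/= ?andTb; [lra|case; lra].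
rewrite measureU//; last first.
  by rewrite -subset0 => z /=; rewrite !in_itv/=; lra.
by rewrite addeAC subee ?add0e// fin_num_measure.
Qed.

Lemma normal_itv_le x y : x <= y -> Phi y - Phi x <= y - x.
Proof.
move=> xy; rewrite -lee_fin -normal_itv// /normal_prob.
apply: (@le_trans _ _ (\int[mu]_(z in `]x, y]) 1%:E)%E).
  apply: ge0_le_integral => //.
  - by move=> z _; rewrite lee_fin normal_pdf_ge0.
  - by apply/measurable_EFinP/measurable_funTS; exact: measurable_normal_pdf.
  - move=> z _; rewrite lee_fin (le_trans (normal_pdf_ub _ _ _)) ?oner_neq0//.
    exact: normal_peak1_le1.
rewrite integral_cst//= mul1e lebesgue_measure_itv/= lte_fin.
by case: ifP => _; rewrite ?lee_fin ?subr_ge0// -EFinB.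
Qed.

Lemma normal_itv_ge x y : 0 <= x -> x <= y -> (y - x) * g y <= Phi y - Phi x.
Proof.
move=> x0 xy; rewrite -lee_fin -normal_itv// /normal_prob.
apply: (@le_trans _ _ (\int[mu]_(z in `]x, y]) (g y)%:E)%E).
  rewrite integral_cst//= lebesgue_measure_itv/= lte_fin.
  case: ltgtP xy => // [xy|->] _; rewrite ?subrr ?mul0r ?mule0//.
  by rewrite -EFinB -EFinM mulrC.
apply: ge0_le_integral => //.
- by move=> z _; rewrite lee_fin normal_pdf_ge0.
- by apply/measurable_EFinP/measurable_funTS; exact: measurable_normal_pdf.
- move=> z /=; rewrite in_itv/= => zxy.
  rewrite lee_fin !normal_pdf01 ler_wpM2l ?normal_peak_ge0// ler_expR.
  by rewrite !mulNr lerN2 ler_pM2r ?invr_gt0// ler_sqr ?nnegrE; lra.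
Qed.

Lemma Phi_nondecreasing x y : x <= y -> Phi x <= Phi y.
Proof. by move=> xy; rewrite -subr_ge0 -lee_fin -normal_itv. Qed.

Lemma normal_pdf01_gt0 x : 0 < g x.
Proof. by rewrite normal_pdf01 mulr_gt0 ?expR_gt0// normal_peak_gt0// oner_neq0. Qed.

Lemma Phi_increasing x y : 0 <= x -> x < y -> Phi x < Phi y.
Proof.
move=> x0 xy; rewrite -subr_gt0 (lt_le_trans _ (normal_itv_ge x0 (ltW xy)))//.
by rewrite mulr_gt0 ?subr_gt0// normal_pdf01_gt0.
Qed.

Lemma normal_tailo x : N `]x, +oo[ = (Phibar x)%:E.
Proof.
rewrite /Phibar EFinB EFin_Phi -(probability_setC N)//.
by congr (N _); rewrite -setCitvl.
Qed.

Lemma normal_set1 x : N [set x] = 0%E.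
Proof. by rewrite /normal_prob integral_set1. Qed.

Lemma normal_tail x : N `[x, +oo[ = (Phibar x)%:E.
Proof.
have -> : (`[x, +oo[ = [set x] `|` `]x, +oo[ :> set R)%classic.
  by apply/seteqP; split => z /=; rewrite !in_itv/= !andbT;
    [rewrite le_eqVlt eq_sym => /predU1P|case=> [->|/ltW]].
transitivity (N [set x] + N `]x, +oo[)%E; last first.
  by rewrite normal_set1 add0e normal_tailo.
by rewrite measureU// -subset0 => z /= [->]; rewrite in_itv/= ltxx.
Qed.

(** Lebesgue measure and the density are both even. *)
Lemma normal_probN (A : set R) : measurable A -> N (-%R @^-1` A) = N A.
Proof.
move=> mA.
have mN : measurable_fun setT
  (-%R : measurableTypeR R -> measurableTypeR R) by [].
have mg : measurable_fun setT (EFin \o g).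
  by apply/measurable_EFinP; exact: measurable_normal_pdf.
have E := @ge0_integral_pushforward _ _ (measurableTypeR R)
  (measurableTypeR R) R _ mN mu A (EFin \o g) mA.
apply/esym; transitivity
  (\int[pushforward mu (-%R : measurableTypeR R -> measurableTypeR R)]_(x in A)
    (EFin \o g) x)%E.
  by apply: eq_measure_integral => B mB _; exact/esym/lebesgue_measureN.
apply: (eq_trans (E _ _)).
- exact: measurable_funTS.
- by move=> x _; rewrite lee_fin normal_pdf_ge0.
by apply: eq_integral => z _ /=; rewrite !normal_pdf01 sqrrN.
Qed.

Lemma PhiN x : Phi (- x) = Phibar x.
Proof.
apply: EFin_inj; rewrite EFin_Phi -normal_tail -normal_probN//.
by congr (N _); apply/seteqP; split => z /=; rewrite !in_itv/= andbT; lra.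
Qed.

Lemma PhibarN x : Phibar (- x) = Phi x.
Proof. by rewrite -PhiN opprK. Qed.

Lemma Phibar_ge0 x : 0 <= Phibar x.
Proof. by rewrite subr_ge0 Phi_le1. Qed.

Lemma Phibar0 : Phibar (0 : R) = 2^-1.
Proof. by have := PhibarN 0; rewrite oppr0 /Phibar; lra. Qed.

Lemma Phibar_nonincreasing x y : x <= y -> Phibar y <= Phibar x.
Proof. by move=> /Phi_nondecreasing; rewrite /Phibar; lra. Qed.

Lemma Phibar_decreasing x y : 0 <= x -> x < y -> Phibar y < Phibar x.
Proof. by move=> x0 /(Phi_increasing x0); rewrite /Phibar; lra. Qed.

Lemma Phibar_lip x y : x <= y -> Phibar x - Phibar y <= y - x.
Proof. by move=> /normal_itv_le; rewrite /Phibar; lra. Qed.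

(** Tilting the Gaussian by [x] moves the tail event to the half-line, where
    the likelihood ratio is at most [expR (- x ^+ 2 / 2)]. *)
Lemma Phibar_le_exp x : 0 <= x -> Phibar x <= expR (- (x ^+ 2) / 2).
Proof.
move=> x0; rewrite -lee_fin -normal_tail.
have -> : (N `[x, +oo[ = \int[N]_z ((\1_`[0, +oo[ (z + (- x)%R)%R)%:E))%E.
  rewrite -[`[x, +oo[%classic]setIT -integral_indic//; apply: eq_integral => z _.
  by rewrite !indicE !mem_setE !in_itv/= !andbT subr_ge0.
rewrite (@normal_shift _ _ (fun z => (\1_`[0, +oo[ z)%:E))//; last first.
  exact/measurable_EFinP/measurable_indic.
apply: (@le_trans _ _ (\int[N]_z (expR (- (x ^+ 2) / 2))%:E)%E); last first.
  by rewrite integral_cst//= [X in (_ * X)%E](probability_setT N) mule1.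
apply: ge0_le_integral => //.
- apply: emeasurable_funM; first exact/measurable_EFinP/measurable_indic.
  by apply/measurable_EFinP/measurableT_comp => //; apply: measurable_funB.
- move=> z _; rewrite -EFinM lee_fin indicE mem_setE in_itv/= andbT.
  case: (leP (0 : R) z) => [z0|_]; last by rewrite mul0r expR_ge0.
  by rewrite mul1r ler_expR sqrrN; have := mulr_ge0 x0 z0; lra.
Qed.

(** The interval from [z] to [z + 1] already has this mass. The shift of [z] by
    one is harmless: it is absorbed in the constant [C] of [Ex_FNP_gbs_Lambda]. *)
Lemma Phibar_ge_exp z : 0 <= z ->
  normal_peak 1 * expR (- ((z + 1) ^+ 2) / 2) <= Phibar z.
Proof.
move=> z0; have := normal_itv_ge z0 (ltac:(lra) : z <= z + 1).
rewrite -normal_pdf01 [z + 1 - z]addrC addKr mul1r => /le_trans; apply.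
by rewrite /Phibar lerD2r Phi_le1.
Qed.

End NormalTails.

(** * Law of a two-sided p-value *)

Section PvalueLaw.
Context {R : realType}.
Implicit Types x y z t c th : R.
Notation N := (@normal_prob R 0 1).

Lemma Phibar_dist x y : `|Phibar x - Phibar y| <= `|x - y|.
Proof.
wlog xy : x y / x <= y => [H|].
  by have [/H//|/ltW/H] := leP x y; rewrite (distrC (Phibar y)) (distrC y).
have := Phibar_lip xy; have := Phibar_nonincreasing xy.
by move=> ? ?; rewrite (distrC x) !(@ger0_norm R (_ - _)) ?subr_ge0.
Qed.

Lemma continuous_Phibar : continuous (@Phibar R).
Proof.
move=> x; apply/cvgrPdist_le => e e0; near=> y.
apply: (le_trans (Phibar_dist _ _)); near: y.
exact: cvgr_dist_le.
Unshelve. all: by end_near. Qed.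

Lemma measurable_Phibar : measurable_fun setT (@Phibar R).
Proof. by apply: continuous_measurable_fun; exact: continuous_Phibar. Qed.

(** The intermediate value theorem is applied on an interval whose right end is
    the exponential bound on the quantile, which localizes it at the same time. *)
Lemma Phibar_quantile c : 0 < c < 1 ->
  exists t, [/\ 0 <= t, t ^+ 2 <= 2 * ln (2 / c) & 2 * Phibar t = c].
Proof.
move=> /andP[c0 c1].
have l0 : 0 <= 2 * ln (2 / c).
  by rewrite mulr_ge0// ln_ge0// ler_pdivlMr// mul1r; lra.
set u := Num.sqrt (2 * ln (2 / c)).
have u0 : 0 <= u by exact: sqrtr_ge0.
have : exists2 t, t \in `[0, u] & Phibar t = c / 2.
  apply: IVT => //; first exact/continuous_subspaceT/continuous_Phibar.
  have ub : Phibar u <= c / 2.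
    apply: le_trans (Phibar_le_exp u0) _.
    rewrite sqr_sqrtr// mulNr mulrAC divff// mul1r expRN lnK ?invf_div//.
    by rewrite posrE divr_gt0.
  by rewrite Phibar0 ge_min le_max ub orbT/=; apply/orP; left; lra.
case=> t; rewrite in_itv/= => /andP[t0 tu] tc; exists t; split => //.
- by rewrite -(sqr_sqrtr l0) ler_sqr ?nnegrE.
- by rewrite tc mulrC divfK.
Qed.

Lemma pvalue_le c t z : 0 <= t -> 2 * Phibar t = c ->
  (2 * Phibar `|z| <= c) = (t <= `|z|).
Proof.
move=> t0 <-; rewrite ler_pM2l//; apply/idP/idP; last exact: Phibar_nonincreasing.
by apply: contraTT; rewrite -!ltNge; exact: Phibar_decreasing.
Qed.

Lemma measurable_abs_ge t th : measurable [set z | t <= `|th + z|].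
Proof.
have -> : [set z | t <= `|th + z|] = (fun z => `|th + z|) @^-1` `[t, +oo[.
  by apply/seteqP; split => z /=; rewrite in_itv/= andbT.
rewrite -[X in measurable X]setTI; apply: measurableT_comp => //.
by apply: measurableT_comp => //; exact: measurable_funD.
Qed.

(** Only the tail on the side of [th] is kept. *)
Lemma normal_abs_ge t th :
  ((Phibar (t - `|th|))%:E <= N [set z | (t <= `|th + z|)%R])%E.
Proof.
have [th0|th0] := leP 0 th.
  rewrite ger0_norm// -normal_tail; apply: le_measure; rewrite ?inE//.
    exact: measurable_abs_ge.
  by move=> z /=; rewrite in_itv/= andbT => tz; rewrite ler_normr; lra.
rewrite ltr0_norm// opprK -PhiN EFin_Phi; apply: le_measure; rewrite ?inE//.
  exact: measurable_abs_ge.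
by move=> z /=; rewrite in_itv/= => tz; rewrite ler_normr; lra.
Qed.

Lemma measurable_pvalue_set c th : measurable [set z : R | 2 * Phibar `|th + z| <= c].
Proof.
rewrite (_ : [set _ | _] = (fun z => 2 * Phibar `|th + z|) @^-1` `]-oo, c]).
  rewrite -[X in measurable X]setTI; apply: measurable_funM => //.
  apply: (measurableT_comp measurable_Phibar).
  by apply: measurableT_comp => //; exact: measurable_funD.
by apply/seteqP; split => z /=; rewrite in_itv.
Qed.

(** A p-value at most [c] is an observation beyond the quantile of [c] on one of
    the two sides, and both tails have mass [c / 2]. *)
Lemma pvalue_null c : 0 < c -> (N [set z | 2 * Phibar `|z| <= c]%R <= c%:E)%E.
Proof.
move=> c0; have [c1|c1] := ltP c 1; last first.
  apply: le_trans (_ : 1%:E <= _)%E => //; apply: probability_le1.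
  by have := measurable_pvalue_set c 0; under eq_set do rewrite add0r.
have [t [t0 _ tc]] := Phibar_quantile (introT andP (conj c0 c1)).
rewrite (_ : [set _ | _] = `]-oo, - t] `|` `[t, +oo[).
  apply: (@le_trans _ _ (N `]-oo, (- t)%R] + N `[t, +oo[)%E).
    exact: measureU2.
  by rewrite normal_tail -EFin_Phi PhiN -EFinD lee_fin -tc; lra.
apply/seteqP; split => z /=; rewrite (pvalue_le _ t0 tc) !in_itv/= andbT ler_normr.
  by case/orP; [right|left; lra].
by case; [move=> ?; apply/orP; right; lra|move=> ->].
Qed.

End PvalueLaw.

(** * Product laws on tuples *)

Section ProductLaw.
Context {R : realType} {n : nat}.
Notation N := (@normal_prob R 0 1).
Implicit Types (x : n.-tuple R) (i j : 'I_n).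

Definition box (B : 'I_n -> set R) : set (n.-tuple R) :=
  [set x | forall i, B i (tnth x i)].

Definition product_law (L : set (n.-tuple R) -> \bar R) : Prop :=
  forall B, (forall i, measurable (B i)) -> L (box B) = (\prod_i N (B i))%E.

Definition upd x i (z : R) : n.-tuple R :=
  [tuple if j == i then z else tnth x j | j < n].

Lemma tnth_upd x i z j : tnth (upd x i z) j = if j == i then z else tnth x j.
Proof. by rewrite tnth_mktuple. Qed.

Lemma measurable_box B : (forall i, measurable (B i)) -> measurable (box B).
Proof.
move=> mB; have -> : box B = \bigcap_(i in [set: 'I_n]) (@tnth _ R ^~ i @^-1` B i).
  by apply/seteqP; split => [x Bx i _|x Bx i]; exact: Bx.
apply: fin_bigcap_measurable => // i _.
by rewrite -[X in measurable X]setTI; exact: measurable_tnth.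
Qed.

Lemma measurable_box_generated :
  measurable = <<s [set box B | B in [set B | forall i, measurable (B i)]] >>.
Proof.
apply/seteqP; split; last first.
  apply: smallest_sub; first exact: sigma_algebra_measurable.
  by move=> _ [B mB <-]; exact: measurable_box.
apply: smallest_sub; first exact: smallest_sigma_algebra.
rewrite -bigcup_seq => A [i _] [B mB] <-; apply: sub_sigma_algebra.
exists (fun j => if j == i then B else setT).
  by move=> j; case: ifP => _ //.
apply/seteqP; split => x /=.
  by move=> /(_ i); rewrite eqxx.
by move=> [_ Bx] j; case: eqP => [->|].
Qed.

(** Boxes form a pi-system that generates the product sigma-algebra. *)
Lemma eq_boxes_eq_measure (L1 L2 : {measure set (n.-tuple R) -> \bar R}) :
  (L1 setT < +oo)%E ->
  (forall B, (forall i, measurable (B i)) -> L1 (box B) = L2 (box B)) ->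
  forall A, measurable A -> L1 A = L2 A.
Proof.
move=> L1oo LE A mA.
apply: (measure_unique [set box B | B in [set B | forall i, measurable (B i)]]
  (fun=> setT)) => //.
- exact: measurable_box_generated.
- move=> _ _ [B mB <-] [C mC <-]; exists (fun i => B i `&` C i).
    by move=> i; exact: measurableI.
  apply/seteqP; split => x /=.
    by move=> BC; split => i; have [] := BC i.
  by move=> [Bx Cx] i; split.
- by move=> _; exists (fun=> setT) => //; apply/seteqP; split.
- by rewrite bigcup_const//; exists 0%N.
- by move=> _ [B mB <-]; exact: LE.
Qed.

Lemma measurable_upd i : measurable_fun setT (fun p : n.-tuple R * R => upd p.1 i p.2).
Proof.
apply/measurable_fun_tnthP => j.
rewrite (_ : _ \o _ = fun p => if j == i then p.2 else tnth p.1 j); last first.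
  by apply/funext => p /=; rewrite tnth_upd.
case: (j == i); first exact: measurable_snd.
apply: (@measurableT_comp _ _ _ _ _ _ (fun x : n.-tuple R => tnth x j) _
  (@fst (n.-tuple R) R)); [exact: measurable_tnth|exact: measurable_fst].
Qed.

Variable L : probability (n.-tuple R) R.
Hypothesis LP : product_law L.

(** Replacing a coordinate by a fresh copy preserves the mass of every box, hence
    the law. This is Fubini's theorem for one coordinate against all others. *)
Lemma ge0_integral_resample i (G : n.-tuple R -> \bar R) :
  measurable_fun setT G -> (forall x, 0 <= G x)%E ->
  (\int[L]_x G x = \int[L]_x \int[N]_z G (upd x i z))%E.
Proof.
move=> mG G0.
pose h (p : n.-tuple R * measurableTypeR R) := upd p.1 i p.2.
have mh : measurable_fun setT h by exact: measurable_upd.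
have E : forall A, measurable A -> L A = pushforward (L \x N)%E h A.
  unshelve (eapply eq_boxes_eq_measure); first exact mh.
    by rewrite [X in (X < _)%E](probability_setT L) ltry.
  move=> B mB; rewrite [LHS](LP mB).
  pose B' j := if j == i then setT else B j.
  have mB' j : measurable (B' j) by rewrite /B'; case: ifP.
  transitivity ((L \x N)%E (box B' `*` B i)); last first.
    congr ((L \x N)%E _); apply/esym/seteqP; split => -[x z] /=.
      move=> Bx; split; last by have := Bx i; rewrite tnth_upd eqxx.
      by move=> j; have := Bx j; rewrite tnth_upd /B'; case: ifP.
    move=> [Bx Bz] j; rewrite tnth_upd; case: eqP => [->//|/eqP ji].
    by have := Bx j; rewrite /B' (negbTE ji).
  apply/esym; apply: (eq_trans (@product_measure1E _ _ (n.-tuple R)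
    (measurableTypeR R) R L N (box B') (B i) (measurable_box mB') (mB i))).
  rewrite [X in (X * _)%E](LP mB') (bigD1 i)//= [in RHS](bigD1 i)//= {1}/B' eqxx.
  rewrite [X in (X * _ * _)%E](probability_setT N) mul1e muleC; congr (_ * _)%E.
  by apply: eq_bigr => j ji; rewrite /B' (negbTE ji).
transitivity (\int[pushforward (L \x N)%E h]_x G x)%E.
  by apply: eq_measure_integral => A mA _; exact: E.
rewrite ge0_integral_pushforward//=.
by rewrite fubini_tonelli1//; exact: measurableT_comp.
Qed.

End ProductLaw.

(** * Expectations of bounded functions *)

Section Expectation.
Context d (T : measurableType d) (R : realType) (P : probability T R).
Implicit Types (f g : T -> R) (c : R).

(** Losses, counts and truncated likelihood ratios are all bounded, so that this
    class, stable under the ring operations, makes integrability automatic. *)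
Definition bmeas f :=
  measurable_fun setT f /\ exists M, forall x, `|f x| <= M.

Definition Ex f : R := \int[P]_x f x.

Lemma bmeas_cst c : bmeas (fun=> c).
Proof. by split => //; exists `|c|. Qed.

Lemma bmeasD f g : bmeas f -> bmeas g -> bmeas (fun x => f x + g x).
Proof.
move=> [mf [M fM]] [mg [K gK]]; split; first exact: measurable_funD.
by exists (M + K) => x; rewrite (le_trans (ler_normD _ _))// lerD.
Qed.

Lemma bmeasM f g : bmeas f -> bmeas g -> bmeas (fun x => f x * g x).
Proof.
move=> [mf [M fM]] [mg [K gK]]; split; first exact: measurable_funM.
by exists (M * K) => x; rewrite normrM ler_pM.
Qed.

Lemma bmeasZ c f : bmeas f -> bmeas (fun x => c * f x).
Proof. by move=> bf; apply: bmeasM => //; exact: bmeas_cst. Qed.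

Lemma bmeasB f g : bmeas f -> bmeas g -> bmeas (fun x => f x - g x).
Proof.
move=> bf bg; apply: bmeasD => //.
by rewrite (_ : (fun x => - g x) = fun x => (-1) * g x);
   [exact: bmeasZ|apply/funext => x; rewrite mulN1r].
Qed.

Lemma bmeas_sum (I : Type) (r : seq I) (p : pred I) (F : I -> T -> R) :
  (forall i, bmeas (F i)) -> bmeas (fun x => \sum_(i <- r | p i) F i x).
Proof.
move=> bF; elim: r => [|i r IH].
  by under eq_fun do rewrite big_nil; exact: bmeas_cst.
under eq_fun do rewrite big_cons.
by case: (p i) => //; exact: bmeasD.
Qed.

Lemma bmeas_integrable f : bmeas f -> P.-integrable setT (EFin \o f).
Proof.
move=> [mf [M fM]]; apply/integrableP; split; first exact/measurable_EFinP.
apply: (@le_lt_trans _ _ (\int[P]_x M%:E)%E).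
  apply: ge0_le_integral => //.
  - by apply/measurable_EFinP/measurableT_comp.
  - by move=> x _; rewrite lee_fin.
by rewrite integral_cst//= [X in (_ * X)%E](probability_setT P) mule1 ltry.
Qed.
Lemma EFin_Ex f : bmeas f -> (Ex f)%:E = (\int[P]_x (f x)%:E)%E.
Proof.
move=> bf; rewrite /Ex /Rintegral fineK//; apply: integrable_fin_num => //.
exact: bmeas_integrable.
Qed.

Lemma Ex_cst c : Ex (fun=> c) = c.
Proof.
by rewrite /Ex Rintegral_cst// [X in fine X](probability_setT P) mulr1.
Qed.

Lemma ExD f g : bmeas f -> bmeas g -> Ex (fun x => f x + g x) = Ex f + Ex g.
Proof. by move=> bf bg; rewrite /Ex RintegralD//; exact: bmeas_integrable. Qed.

Lemma ExB f g : bmeas f -> bmeas g -> Ex (fun x => f x - g x) = Ex f - Ex g.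
Proof. by move=> bf bg; rewrite /Ex RintegralB//; exact: bmeas_integrable. Qed.

Lemma ExZ c f : bmeas f -> Ex (fun x => c * f x) = c * Ex f.
Proof. by move=> bf; rewrite /Ex RintegralZl//; exact: bmeas_integrable. Qed.

Lemma le_Ex f g : bmeas f -> bmeas g -> (forall x, f x <= g x) -> Ex f <= Ex g.
Proof.
by move=> bf bg fg; apply: le_Rintegral => //; exact: bmeas_integrable.
Qed.

Lemma eq_Ex f g : f =1 g -> Ex f = Ex g.
Proof. by move=> /funext ->. Qed.

Lemma Ex_ge0 f : (forall x, 0 <= f x) -> 0 <= Ex f.
Proof. by move=> f0; apply: Rintegral_ge0. Qed.

Lemma Ex_sum (I : Type) (r : seq I) (p : pred I) (F : I -> T -> R) :
  (forall i, bmeas (F i)) ->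
  Ex (fun x => \sum_(i <- r | p i) F i x) = \sum_(i <- r | p i) Ex (F i).
Proof.
move=> bF; elim: r => [|i r IH].
  by under eq_Ex do rewrite big_nil; rewrite Ex_cst big_nil.
under eq_Ex do rewrite big_cons; rewrite big_cons.
by case: (p i) => //; rewrite ExD ?IH//; exact: bmeas_sum.
Qed.

(** Fibres suffice for a finite target, which then needs no sigma-algebra of its
    own. *)
Definition dmeas (F : finType) (D : T -> F) :=
  forall t, measurable (D @^-1` [set t]).

Lemma dmeas_setP (F : finType) (D : T -> F) (Q : F -> bool) :
  dmeas D -> measurable [set x | Q (D x)].
Proof.
move=> mD; rewrite (_ : [set _ | _] = \bigcup_(t in [set t | Q t]) (D @^-1` [set t])).
  by apply: fin_bigcup_measurable => // t _; exact: mD.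
by apply/seteqP; split => [x /= Qx|x [t /= Qt /= ->]//]; exists (D x).
Qed.

Lemma dmeas_bool (b : T -> bool) : measurable [set x | b x] -> dmeas b.
Proof.
move=> mb [].
  by rewrite (_ : _ @^-1` _ = [set x | b x]).
rewrite (_ : _ @^-1` _ = ~` [set x | b x]); first exact: measurableC.
by apply/seteqP; split => x /=; case: (b x).
Qed.

Lemma dmeas_ffun (I F : finType) (D : I -> T -> F) :
  (forall i, dmeas (D i)) -> dmeas (fun x => [ffun i => D i x]).
Proof.
move=> mD t.
rewrite (_ : _ @^-1` _ = \bigcap_(i in [set: I]) (D i @^-1` [set t i])).
  by apply: fin_bigcap_measurable => // i _; exact: mD.
apply/seteqP; split => [x /= <- i _|x /= Dx]; first by rewrite /= ffunE.
by apply/ffunP => i; rewrite ffunE; exact: Dx.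
Qed.

Lemma bmeas_comp (F : finType) (D : T -> F) (h : F -> R) :
  dmeas D -> bmeas (fun x => h (D x)).
Proof.
move=> mD; split; last first.
  exists (\sum_t `|h t|) => x.
  by rewrite (bigD1 (D x))//= lerDl sumr_ge0.
move=> _ Y mY; rewrite setTI.
have := dmeas_setP (fun u => `[< Y (h u) >]) mD.
by congr measurable; apply/seteqP; split => x /= /asboolP.
Qed.

Lemma bmeas_bool (b : T -> bool) : measurable [set x | b x] ->
  bmeas (fun x => (b x)%:R).
Proof. by move=> /dmeas_bool; exact: (bmeas_comp (fun b : bool => b%:R)). Qed.

Lemma EFin_Ex_bool (b : T -> bool) : measurable [set x | b x] ->
  (Ex (fun x => (b x)%:R))%:E = P [set x | b x].
Proof.
move=> mb; rewrite EFin_Ex; last exact: bmeas_bool.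
rewrite -[in RHS](setIT [set x | b x]) -integral_indic//.
by apply: eq_integral => x _; rewrite indicE mem_setE.
Qed.

End Expectation.

(** * Expectations under the product law *)

Section ProductLawExpectation.
Context {R : realType} {n : nat}.
Notation N := (@normal_prob R 0 1).
Implicit Types (x theta : n.-tuple R) (i j : 'I_n).
Variable L : probability (n.-tuple R) R.
Hypothesis LP : product_law L.

Definition obs theta x : n.-tuple R :=
  [tuple tnth theta i + tnth x i | i < n].

Lemma tnth_obs theta x i : tnth (obs theta x) i = tnth theta i + tnth x i.
Proof. by rewrite tnth_mktuple. Qed.

Lemma measurable_obs theta : measurable_fun setT (obs theta).
Proof.
apply/measurable_fun_tnthP => i.
rewrite (_ : _ \o _ = fun x : n.-tuple R => tnth theta i + tnth x i); last first.
  by apply/funext => x /=; rewrite tnth_obs.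
by apply: measurable_funD => //; exact: measurable_tnth.
Qed.

Lemma bmeas_obs theta (f : n.-tuple R -> R) :
  bmeas f -> bmeas (fun x => f (obs theta x)).
Proof.
move=> [mf [M fM]]; split; last by exists M.
by apply: measurableT_comp => //; exact: measurable_obs.
Qed.

Lemma dmeas_obs (F : finType) theta (D : n.-tuple R -> F) :
  dmeas D -> dmeas (fun x => D (obs theta x)).
Proof.
move=> mD t; rewrite -[X in measurable X]setTI.
exact: (measurable_obs theta measurableT (mD t)).
Qed.

(** A bound on the conditional expectation given all coordinates but [i]. *)
Lemma Ex_resample_le i (G : n.-tuple R -> R) (c : R) :
  bmeas G -> (forall x, 0 <= G x) ->
  (forall x, \int[N]_z (G (upd x i z))%:E <= c%:E)%E -> Ex L G <= c.
Proof.
move=> bG G0 Gc; have mG : measurable_fun setT (EFin \o G).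
  by apply/measurable_EFinP; case: bG.
rewrite -lee_fin EFin_Ex// (ge0_integral_resample LP i (G := EFin \o G))//.
apply: (@le_trans _ _ (\int[L]_x c%:E)%E); last first.
  by rewrite integral_cst//= [X in (_ * X)%E](probability_setT L) mule1.
apply: ge0_le_integral => //.
- by move=> x _; apply: integral_ge0 => z _; rewrite lee_fin.
- have m2 : measurable_fun setT
    (fun p : n.-tuple R * R => (G (upd p.1 i p.2))%:E).
    exact: (measurableT_comp mG (measurable_upd i)).
  apply: (@measurable_fun_fubini_tonelli_F _ _ (n.-tuple R) (measurableTypeR R)
    R N (fun p : n.-tuple R * R => (G (upd p.1 i p.2))%:E)); first exact: m2.
  by move=> p; rewrite lee_fin.
- by move=> x _; exact: Gc.
Qed.

Lemma product_law_marginal i (A : set R) : measurable A ->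
  L [set x | A (tnth x i)] = N A.
Proof.
move=> mA; pose B j := if j == i then A else setT.
have mB j : measurable (B j) by rewrite /B; case: ifP.
transitivity (L (box B)).
  congr (L _); apply/seteqP; split => x /=.
    by move=> Ax j; rewrite /B; case: eqP => // ->.
  by move=> /(_ i); rewrite /B eqxx.
rewrite LP// (bigD1 i)//= {1}/B eqxx big1 ?mule1// => j ji.
by rewrite /B (negbTE ji) [LHS](probability_setT N).
Qed.

Lemma product_law_pair i j (A B : set R) : i != j ->
  measurable A -> measurable B ->
  L [set x | A (tnth x i) /\ B (tnth x j)] = (N A * N B)%E.
Proof.
move=> ij mA mB; pose C k := if k == i then A else if k == j then B else setT.
have mC k : measurable (C k) by rewrite /C; case: (k == i); case: (k == j).
transitivity (L (box C)).
  congr (L _); apply/seteqP; split => x /=.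
    by move=> [Ax Bx] k; rewrite /C; case: eqP => [->|_]//; case: eqP => // ->.
  move=> Cx; have := Cx i; have := Cx j; rewrite /C !eqxx eq_sym (negbTE ij).
  by [].
rewrite LP// (bigD1 i)//= {1}/C eqxx (bigD1 j)/=; last by rewrite eq_sym.
rewrite {1}/C eqxx eq_sym (negbTE ij) big1 ?mule1// => k /andP[ki kj].
by rewrite /C (negbTE ki) (negbTE kj) [LHS](probability_setT N).
Qed.

(** Cameron--Martin along one coordinate: translating the [i]-th coordinate
    is the same as reweighting by the likelihood ratio. *)
Lemma ge0_integral_shift_coord i (a : R) (H : n.-tuple R -> \bar R) :
  measurable_fun setT H -> (forall x, 0 <= H x)%E ->
  (\int[L]_x H (upd x i (tnth x i + a)%R) =
   \int[L]_x (H x * (expR (a * tnth x i - a ^+ 2 / 2))%:E))%E.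
Proof.
move=> mH H0.
have mt : measurable_fun setT (fun x : n.-tuple R => tnth x i).
  exact: measurable_tnth.
rewrite (ge0_integral_resample LP i); last 2 first.
- apply: (measurableT_comp mH); apply/measurable_fun_tnthP => j.
  rewrite (_ : _ \o _ = fun x : n.-tuple R =>
      if j == i then tnth x i + a else tnth x j); last first.
    by apply/funext => x /=; rewrite tnth_upd.
  case: (j == i); last exact: measurable_tnth.
  exact: measurable_funD.
- by move=> x; exact: H0.
rewrite [RHS](ge0_integral_resample LP i); last 2 first.
- apply: emeasurable_funM => //; apply/measurable_EFinP.
  apply: measurableT_comp => //; apply: measurable_funB => //.
  exact: measurable_funM.
- by move=> x; rewrite mule_ge0// lee_fin expR_ge0.
apply: eq_integral => x _.
have mHx : measurable_fun setT (fun z => H (upd x i z)).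
  apply: (measurableT_comp mH); apply/measurable_fun_tnthP => j.
  rewrite (_ : _ \o _ = fun z : R => if j == i then z else tnth x j); last first.
    by apply/funext => z /=; rewrite tnth_upd.
  by case: (j == i).
transitivity (\int[N]_z H (upd x i (z + a)%R))%E.
  apply: eq_integral => z _; rewrite tnth_upd eqxx; congr H.
  by apply: eq_from_tnth => j; rewrite !tnth_upd; case: eqP.
apply: (eq_trans (normal_shift a mHx _)); first by move=> z; exact: H0.
by apply: eq_integral => z _; rewrite tnth_upd eqxx.
Qed.

End ProductLawExpectation.

(** * Combinatorics of the step-down rule *)

Section GBSCombinatorics.
Context {R : realType} {n : nat}.
Variable alpha : R.
Hypothesis alpha01 : 0 < alpha < 1.
Implicit Types (x : n.-tuple R) (i k : 'I_n) (r j : nat) (c : R).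
Notation thr := (gbs_threshold n alpha).
Notation count_gbs := (gbs_count alpha).

Let a0 : 0 < alpha. Proof. by case/andP: alpha01. Qed.
Let a1 : alpha < 1. Proof. by case/andP: alpha01. Qed.

Lemma threshold_den_ge j : (j <= n)%N ->
  n.+1%:R - j%:R <= n.+1%:R - j%:R * (1 - alpha).
Proof.
by move=> jn; rewrite mulrBr mulr1; have := mulr_ge0 (ler0n R j) (ltW a0); lra.
Qed.

Lemma threshold_den_gt0 j : (j <= n)%N -> 0 < n.+1%:R - j%:R * (1 - alpha).
Proof.
move=> jn; apply: lt_le_trans (threshold_den_ge jn).
by rewrite subr_gt0 ltr_nat ltnS.
Qed.

Lemma threshold_gt0 j : (0 < j <= n)%N -> 0 < thr j.
Proof.
by move=> /andP[j0 jn]; rewrite divr_gt0 ?threshold_den_gt0// mulr_gt0// ltr0n.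
Qed.

Lemma threshold_lt1 j : (0 < j <= n)%N -> thr j < 1.
Proof.
move=> /andP[j0 jn]; rewrite ltr_pdivrMr ?threshold_den_gt0// mul1r.
have : j%:R < n.+1%:R :> R by rewrite ltr_nat ltnS.
by rewrite mulrBr mulr1; lra.
Qed.

Lemma threshold_mono j r : (j <= r)%N -> (r <= n)%N -> thr j <= thr r.
Proof.
move=> jr rn; have jr' : j%:R <= r%:R :> R by rewrite ler_nat.
apply: ler_pM.
- by rewrite mulr_ge0 ?ler0n// ltW.
- by rewrite invr_ge0 ltW// threshold_den_gt0// (leq_trans jr).
- by rewrite ler_wpM2r// ltW.
- rewrite lef_pV2 ?posrE ?threshold_den_gt0// ?(leq_trans jr)//.
  by rewrite lerD2l lerN2 ler_wpM2r// subr_ge0 ltW.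
Qed.

Lemma threshold_ge j : (j <= n)%N -> j%:R * alpha / n.+1%:R <= thr j.
Proof.
move=> jn; rewrite ler_wpM2l ?mulr_ge0 ?ler0n// ?(ltW a0)//.
rewrite lef_pV2 ?posrE ?threshold_den_gt0// gerBl.
by rewrite mulr_ge0 ?ler0n// subr_ge0 ltW.
Qed.

(** Up to half of [n.+1] the denominator is at least [n.+1 / 2], so the critical
    constants are within a factor two of the linear ones. *)
Lemma threshold_le_double j : (j.*2 <= n.+1)%N ->
  thr j <= j%:R * (2 * alpha / n.+1%:R).
Proof.
move=> jn; have jn' : 2 * j%:R <= n.+1%:R :> R.
  by rewrite -natrM mul2n ler_nat.
have jn2 : (j <= n)%N by lia.
rewrite ler_pdivrMr ?threshold_den_gt0//.
have nn : 0 < n.+1%:R :> R by rewrite ltr0n.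
have D : n.+1%:R / 2 <= n.+1%:R - j%:R * (1 - alpha) :> R.
  by apply: le_trans (threshold_den_ge jn2); lra.
have -> : j%:R * alpha = j%:R * (2 * alpha / n.+1%:R) * (n.+1%:R / 2).
  by field; rewrite lt0r_neq0.
by rewrite ler_wpM2l// !mulr_ge0 ?ler0n ?invr_ge0// ltW.
Qed.

Lemma count_sorted_pvalues x c :
  count (<= c) (sorted_pvalues x) = #|[pred k | pvalue x k <= c]|.
Proof.
rewrite (permP (permEl (perm_sort _ _))) count_map cardE size_filter.
rewrite [in LHS]enumT; apply: eq_count => k.
by rewrite /= ?inE.
Qed.

Lemma sorted_sorted_pvalues x : sorted <=%R (sorted_pvalues x).
Proof. exact: sort_sorted le_total _. Qed.

Lemma size_sorted_pvalues x : size (sorted_pvalues x) = n.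
Proof. by rewrite size_sort size_map -cardE card_ord. Qed.

Lemma ordered_pvalue_le x c j : (0 < j <= n)%N ->
  (ordered_pvalue x j <= c) = (j <= #|[pred k | (pvalue x k <= c)%R]|)%N.
Proof.
case: j => // j /= jn; rewrite -count_sorted_pvalues /ordered_pvalue/=.
have S := sorted_sorted_pvalues x.
apply/idP/idP; last by move=> ?; exact: nth_count_le.
apply: contraTT; rewrite -leqNgt -ltNge => H.
by apply: nth_count_gt => //; rewrite H size_sorted_pvalues.
Qed.

(** The [j]-th smallest p-value is below [thr j] exactly when at least [j] p-values
    are: the procedure depends on counts only. *)
Lemma gbs_count_geP x r : (r <= count_gbs x)%N <->
  (r <= n)%N /\
  forall j, (0 < j <= r)%N -> (j <= #|[pred k | (pvalue x k <= thr j)%R]|)%N.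
Proof.
pose Q r' := all (fun j => ordered_pvalue x j <= thr j) (iota 1 r').
have QP r' : (r' <= n)%N -> Q r' <->
    forall j, (0 < j <= r')%N -> (j <= #|[pred k | (pvalue x k <= thr j)%R]|)%N.
  move=> r'n; split => [/allP H j /andP[j0 jr]|H].
    rewrite -ordered_pvalue_le; last by rewrite j0 (leq_trans jr).
    by apply: H; rewrite mem_iota j0 add1n ltnS.
  apply/allP => j; rewrite mem_iota add1n ltnS => /andP[j0 jr].
  rewrite ordered_pvalue_le; first by apply: H; rewrite j0.
  by rewrite j0 (leq_trans jr).
have [r0 Qr0 er0] : {r0 : 'I_n.+1 | Q r0 & count_gbs x = r0}.
  have Q0 : (0 < #|[pred r' : 'I_n.+1 | Q r']|)%N by apply/card_gt0P; exists ord0.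
  have [r1 Qr1 er1] := eq_bigmax_cond (fun r' : 'I_n.+1 => r' : nat) Q0.
  by exists r1.
rewrite er0; split => [rr0|[rn H]].
  have rn : (r <= n)%N by apply: leq_trans rr0 _; rewrite -ltnS.
  split => // j /andP[j0 jr].
  have /QP : (r0 <= n)%N by rewrite -ltnS.
  by move=> [/(_ Qr0) + _]; apply; rewrite j0 (leq_trans jr).
rewrite -er0 -[r]/(nat_of_ord (Ordinal (rn : (r < n.+1)%N))).
by apply: (@leq_bigmax_cond _ _ (fun r' : 'I_n.+1 => r' : nat)); apply/QP.
Qed.

Lemma gbs_count_le x : (count_gbs x <= n)%N.
Proof. by have [/(_ (leqnn _))[]] := gbs_count_geP x (count_gbs x). Qed.

Lemma gbs_count_pvalues x j : (0 < j <= count_gbs x)%N ->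
  (j <= #|[pred k | (pvalue x k <= thr j)%R]|)%N.
Proof. by have [/(_ (leqnn _))[_ H] _] := gbs_count_geP x (count_gbs x); exact: H. Qed.

Lemma card_pvalue_le_mono x c c' : c <= c' ->
  (#|[pred k | (pvalue x k <= c)%R]| <= #|[pred k | (pvalue x k <= c')%R]|)%N.
Proof.
by move=> cc'; apply/subset_leq_card/fintype.subsetP => k; rewrite !inE => /le_trans; apply.
Qed.

(** By maximality, the number of p-values below the critical constant reached
    is exactly the number of steps made: one more would allow a further step. *)
Lemma gbs_countE x : (0 < count_gbs x)%N ->
  #|[pred k | (pvalue x k <= thr (count_gbs x))%R]| = count_gbs x.
Proof.
move=> r0; apply/eqP; rewrite eqn_leq gbs_count_pvalues ?r0 ?leqnn// andbT.
rewrite leqNgt; apply/negP => lt.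
suff : (count_gbs x < count_gbs x)%N by rewrite ltnn.
have rn : (count_gbs x < n)%N.
  by rewrite (leq_trans lt)// (leq_trans (max_card _))// card_ord.
apply/gbs_count_geP; split=> // j /andP[j0].
rewrite leq_eqVlt => /predU1P[->|jr]; last by rewrite gbs_count_pvalues// j0.
by apply: leq_trans lt _; apply: card_pvalue_le_mono; exact: threshold_mono.
Qed.

(** A p-value below the critical constant reached but outside the first
    [gbs_count] ordered values would be one too many for [gbs_countE]. *)
Lemma gbs_rejectE x i :
  tnth (gbs alpha x) i =
  (0 < count_gbs x)%N && (pvalue x i <= thr (count_gbs x)).
Proof.
rewrite tnth_mktuple; set r := count_gbs x.
have [r0|] := ltnP 0 r; last by rewrite leqn0 => /eqP ->; rewrite take0.
have S := sorted_sorted_pvalues x.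
have rn : (r <= n)%N by exact: gbs_count_le.
apply/idP/idP => [|pr].
  move=> /(nthP 0) [j]; rewrite size_takel ?size_sorted_pvalues// => jr.
  rewrite nth_take// => <-; rewrite -[j]/(j.+1.-1) -/(ordered_pvalue x j.+1).
  rewrite ordered_pvalue_le ?(leq_trans jr)//.
  by rewrite gbs_countE.
apply/negPn/negP => nin.
have E : all (<= thr r) (take r (sorted_pvalues x)).
  apply/(all_nthP 0) => j; rewrite size_takel ?size_sorted_pvalues// => jr.
  rewrite nth_take// -[j]/(j.+1.-1) -/(ordered_pvalue x j.+1).
  by rewrite /= ordered_pvalue_le ?(leq_trans jr)// gbs_countE.
have : pvalue x i \in sorted_pvalues x.
  by rewrite mem_sort; apply: map_f; rewrite mem_enum.
rewrite -(cat_take_drop r (sorted_pvalues x)) mem_cat (negbTE nin) /= => iD.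
have := gbs_countE r0; rewrite -count_sorted_pvalues.
rewrite -{1}(cat_take_drop r (sorted_pvalues x)) count_cat.
move: E; rewrite all_count => /eqP ->; rewrite size_takel ?size_sorted_pvalues//.
have : (0 < count (<= thr r) (drop r (sorted_pvalues x)))%N.
  by rewrite -has_count; apply/hasP; exists (pvalue x i).
by rewrite -/r; lia.
Qed.

Lemma sum_gbs x : (\sum_(i < n) tnth (gbs alpha x) i = count_gbs x)%N.
Proof.
under eq_bigr do rewrite gbs_rejectE.
have [r0|r0] := ltnP 0 (count_gbs x); last first.
  by rewrite big1//; apply/eqP; rewrite eq_sym -leqn0.
rewrite -[RHS](gbs_countE r0) -sum1_card [RHS]big_mkcond/=.
by apply: eq_bigr => i _; rewrite inE; case: ifP.
Qed.

Lemma pvalue_upd x i z k : k != i -> pvalue (upd x i z) k = pvalue x k.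
Proof. by move=> ki; rewrite /pvalue tnth_upd (negbTE ki). Qed.

(** Once hypothesis [i] is rejected, the number of steps no longer depends on
    its p-value: lowering that p-value cannot enable a further step. *)
Lemma gbs_count_upd x i z z' :
  tnth (gbs alpha (upd x i z)) i -> tnth (gbs alpha (upd x i z')) i ->
  count_gbs (upd x i z) = count_gbs (upd x i z').
Proof.
wlog suff H : z z' / tnth (gbs alpha (upd x i z)) i ->
    tnth (gbs alpha (upd x i z')) i ->
    (count_gbs (upd x i z) <= count_gbs (upd x i z'))%N.
  by move=> iz iz'; apply/eqP; rewrite eqn_leq !H.
move=> iz iz'; have /andP[r0 pz] := etrans (esym (gbs_rejectE (upd x i z) i)) iz.
have /andP[r0' pz'] := etrans (esym (gbs_rejectE (upd x i z') i)) iz'.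
clear iz iz'.
set r := count_gbs (upd x i z) in r0 pz *.
set r' := count_gbs (upd x i z') in r0' pz' *.
rewrite leqNgt; apply/negP => rr'.
suff : (r' < r')%N by rewrite ltnn.
have rn : (r <= n)%N by exact: gbs_count_le.
apply/gbs_count_geP; split; first exact: leq_trans rn.
move=> j /andP[j0]; rewrite leq_eqVlt => /predU1P[->|jr]; last first.
  by rewrite gbs_count_pvalues// j0.
apply: leq_trans (_ : (#|[pred k | (pvalue (upd x i z) k <= thr r'.+1)%R]| <= _)%N).
  by rewrite gbs_count_pvalues.
apply/subset_leq_card/fintype.subsetP => k; rewrite !inE.
have [->|ki] := eqVneq k i; last by rewrite !pvalue_upd.
move=> _; apply: le_trans pz' _; apply: threshold_mono => //.
exact: leq_trans rn.
Qed.

End GBSCombinatorics.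

(** * Measurability of the procedure and laws of its p-values *)

Section GBSMeasurable.
Context {R : realType} {n : nat}.
Implicit Types (x y : n.-tuple R) (i k : 'I_n).

Lemma dmeas_factor d (T : measurableType d) (F G : finType) (D : T -> F) (E : T -> G) :
  dmeas D -> (forall u v, D u = D v -> E u = E v) -> dmeas E.
Proof.
move=> mD DE t.
have := dmeas_setP (fun u => `[< exists v, D v = u /\ E v = t >]) mD.
congr measurable; apply/seteqP; split => x /=.
  by move=> /asboolP[y [/DE <-]].
by move=> Ext; apply/asboolP; exists x.
Qed.

Lemma measurable_upd_at x i : measurable_fun setT (upd x i).
Proof.
apply/measurable_fun_tnthP => j.
rewrite (_ : _ \o _ = fun z : R => if j == i then z else tnth x j); last first.
  by apply/funext => z /=; rewrite tnth_upd.
by case: (j == i).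
Qed.

Lemma measurable_pvalue i : measurable_fun setT (fun x => pvalue x i).
Proof.
apply: measurable_funM => //; apply: (measurableT_comp measurable_Phibar).
by apply: measurableT_comp => //; exact: measurable_tnth.
Qed.

Lemma measurable_pvalue_le i (c : R) : measurable [set x | pvalue x i <= c].
Proof.
rewrite (_ : [set _ | _] = (fun x => pvalue x i) @^-1` `]-oo, c]).
  by rewrite -[X in measurable X]setTI; exact: measurable_pvalue.
by apply/seteqP; split => x /=; rewrite in_itv.
Qed.

Variable alpha : R.
Hypothesis alpha01 : 0 < alpha < 1.
Notation thr := (gbs_threshold n alpha).
Notation count_gbs := (gbs_count alpha).

(** The finitely many comparisons through which the procedure sees the data. *)
Definition pvalue_bits x : {ffun 'I_n * 'I_n.+1 -> bool} :=
  [ffun p : 'I_n * 'I_n.+1 => pvalue x p.1 <= thr p.2].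

Lemma dmeas_pvalue_bits : dmeas pvalue_bits.
Proof.
apply: (dmeas_ffun (D := fun (p : 'I_n * 'I_n.+1) x => pvalue x p.1 <= thr p.2)) => p.
by apply: dmeas_bool; exact: measurable_pvalue_le.
Qed.

Lemma pvalue_bits_le x y j k : pvalue_bits x = pvalue_bits y -> (j <= n)%N ->
  (pvalue x k <= thr j) = (pvalue y k <= thr j).
Proof.
move=> /ffunP xy jn; have := xy (k, Ordinal (jn : (j < n.+1)%N)).
by rewrite !ffunE.
Qed.

Lemma gbs_count_bits x y : pvalue_bits x = pvalue_bits y ->
  count_gbs x = count_gbs y.
Proof.
wlog suff H : x y / pvalue_bits x = pvalue_bits y ->
    (count_gbs x <= count_gbs y)%N.
  by move=> xy; apply/eqP; rewrite eqn_leq !H.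
move=> xy; apply/gbs_count_geP; split; first exact: gbs_count_le.
move=> j jr; rewrite (leq_trans (gbs_count_pvalues jr))//.
apply/subset_leq_card/fintype.subsetP => k; rewrite !inE (pvalue_bits_le _ xy)//.
by case/andP: jr => _ /leq_trans; apply; exact: gbs_count_le.
Qed.

Lemma gbs_bits x y : pvalue_bits x = pvalue_bits y -> gbs alpha x = gbs alpha y.
Proof.
move=> xy; apply: eq_from_tnth => i.
rewrite (gbs_rejectE alpha01 x i) (gbs_rejectE alpha01 y i).
rewrite (gbs_count_bits xy) (pvalue_bits_le _ xy)//; exact: gbs_count_le.
Qed.

Lemma dmeas_gbs : dmeas (gbs alpha : n.-tuple R -> n.-tuple bool).
Proof. exact: dmeas_factor dmeas_pvalue_bits gbs_bits. Qed.

End GBSMeasurable.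

Section PvalueExpectation.
Context {R : realType} {n : nat}.
Notation N := (@normal_prob R 0 1).
Implicit Types (x theta : n.-tuple R) (i : 'I_n) (c t : R).
Variable L : probability (n.-tuple R) R.
Hypothesis LP : product_law L.

Lemma measurable_pvalue_obs theta i c :
  measurable [set x | pvalue (obs theta x) i <= c].
Proof.
rewrite -[X in measurable X]setTI.
exact: (measurable_obs theta measurableT (measurable_pvalue_le i c)).
Qed.

Lemma EFin_Ex_pvalue theta i c :
  (Ex L (fun x => (pvalue (obs theta x) i <= c)%R%:R))%:E =
  N [set z | 2 * Phibar `|tnth theta i + z| <= c]%R.
Proof.
rewrite EFin_Ex_bool; last exact: measurable_pvalue_obs.
rewrite -(product_law_marginal LP i).
  by congr (L _); apply/seteqP; split => x; rewrite /= /pvalue tnth_obs.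
exact: measurable_pvalue_set.
Qed.

Lemma Ex_pvalue_null theta i c : tnth theta i = 0 -> 0 < c ->
  Ex L (fun x => (pvalue (obs theta x) i <= c)%R%:R) <= c.
Proof.
move=> th0 c0; rewrite -lee_fin EFin_Ex_pvalue th0.
by under eq_set do rewrite add0r; exact: pvalue_null.
Qed.

Lemma Ex_pvalue_alt theta i c t : 0 <= t -> 2 * Phibar t = c ->
  Phibar (t - `|tnth theta i|) <=
  Ex L (fun x => (pvalue (obs theta x) i <= c)%R%:R).
Proof.
move=> t0 tc; rewrite -lee_fin EFin_Ex_pvalue.
under eq_set do rewrite (pvalue_le _ t0 tc).
exact: normal_abs_ge.
Qed.

End PvalueExpectation.

(** * Control of the false discovery proportion *)

Section FDPControl.
Context {R : realType} {n : nat}.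
Notation N := (@normal_prob R 0 1).
Implicit Types (x y theta : n.-tuple R) (i : 'I_n) (phi : n.-tuple bool).
Variable L : probability (n.-tuple R) R.
Hypothesis LP : product_law L.
Variable alpha : R.
Hypothesis alpha01 : 0 < alpha < 1.
Notation thr := (gbs_threshold n alpha).
Notation count_gbs := (gbs_count alpha).

Let a0 : 0 < alpha. Proof. by case/andP: alpha01. Qed.

Lemma sum_const_le (p : pred 'I_n) (c : R) : 0 <= c ->
  \sum_(i < n | p i) c <= c * n%:R.
Proof.
move=> c0; rewrite sumr_const -[leLHS]mulr_natr ler_wpM2l// ler_nat.
by rewrite -[leqRHS]card_ord max_card.
Qed.

(** The share of hypothesis [i] in the false discovery proportion, cut off beyond
    half of the hypotheses, where [thr j / j] is no longer of order [alpha / n]. *)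
Definition rejection_share i phi : R :=
  (tnth phi i && ((\sum_(k < n) tnth phi k).*2 <= n.+1)%N)%:R
  / (maxn 1 (\sum_(k < n) tnth phi k))%:R.

Lemma rejection_share_ge0 i phi : 0 <= rejection_share i phi.
Proof. by rewrite divr_ge0 ?ler0n. Qed.

(** Given the other observations, the number [r] of rejections is fixed on the
    event that hypothesis [i] is rejected, and this event then requires a
    p-value below [thr r <= r * (2 * alpha / n.+1)]. *)
Lemma rejection_share_bound theta i : tnth theta i = 0 ->
  Ex L (fun x => rejection_share i (gbs alpha (obs theta x))) <=
  2 * alpha / n.+1%:R.
Proof.
move=> th0.
have an0 : 0 <= 2 * alpha / n.+1%:R :> R by rewrite divr_ge0// mulr_ge0// ltW.
have bG : bmeas (fun x => rejection_share i (gbs alpha x)).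
  by apply: (bmeas_comp (rejection_share i)); exact: dmeas_gbs.
apply: (Ex_resample_le LP (i := i)); first exact: (bmeas_obs theta bG).
  by move=> x; exact: rejection_share_ge0.
move=> x; have E z : obs theta (upd x i z) = upd (obs theta x) i z.
  apply: eq_from_tnth => j; rewrite tnth_obs !tnth_upd tnth_obs.
  by case: eqP => // ->; rewrite th0 add0r.
under eq_integral do rewrite E.
set y := obs theta x.
pose Q z := tnth (gbs alpha (upd y i z)) i && ((count_gbs (upd y i z)).*2 <= n.+1)%N.
have ShE z : rejection_share i (gbs alpha (upd y i z)) =
    (Q z)%:R / (maxn 1 (count_gbs (upd y i z)))%:R.
  by rewrite /rejection_share sum_gbs.
have [[z0 Qz0]|nQ] := pselect (exists z, Q z); last first.
  rewrite integral0_eq// => z _; rewrite ShE.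
  by case: (boolP (Q z)) => [Qz|]; [exfalso; apply: nQ; exists z|rewrite mul0r].
set r := count_gbs (upd y i z0).
have /andP[rej0 rn] := Qz0.
have r0 : (0 < r)%N.
  by move: rej0; rewrite (gbs_rejectE alpha01 (upd y i z0) i) => /andP[].
have rle : (r <= n)%N by exact: gbs_count_le.
have c0 : 0 < thr r by rewrite threshold_gt0// r0.
have rR : 0 < r%:R :> R by rewrite ltr0n.
have mp : measurable [set z : R | 2 * Phibar `|z| <= thr r].
  by have := measurable_pvalue_set (thr r) 0; under eq_set do rewrite add0r.
apply: (@le_trans _ _
  (\int[N]_z (r%:R^-1 * (2 * Phibar `|z| <= thr r)%R%:R)%:E)%E); last first.
  have bI : bmeas (fun z : R => (2 * Phibar `|z| <= thr r)%R%:R : R).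
    exact: bmeas_bool.
  rewrite -EFin_Ex; last exact: bmeasZ.
  rewrite ExZ// lee_fin mulrC ler_pdivrMr// mulrC.
  apply: le_trans (threshold_le_double alpha01 rn).
  by rewrite -lee_fin EFin_Ex_bool//; exact: pvalue_null.
apply: ge0_le_integral => //.
- by move=> z _; rewrite lee_fin rejection_share_ge0.
- apply/measurable_EFinP; case: bG => mG _.
  exact: (measurableT_comp mG (measurable_upd_at y i)).
- apply/measurable_EFinP; apply: measurable_funM => //.
  by have [] := bmeas_bool R mp.
- move=> z _; rewrite lee_fin ShE; case: (boolP (Q z)) => [Qz|_]; last first.
    by rewrite mul0r mulr_ge0// invr_ge0 ltW.
  have /andP[rej _] := Qz.
  have er : count_gbs (upd y i z) = r by exact: gbs_count_upd.
  rewrite er (maxn_idPr r0) mul1r ler_peMr ?invr_ge0 ?(ltW rR)//.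
  move: rej; rewrite (gbs_rejectE alpha01 (upd y i z) i) => /andP[_].
  by rewrite er /pvalue tnth_upd eqxx => ->.
Qed.

(** More than half of all hypotheses are rejected only if at least a quarter of
    them are true nulls with p-value at most [alpha]; Markov's inequality. *)
Lemma many_rejections_bound theta :
  (0 < n)%N -> (4 * #|support_set theta| <= n)%N ->
  Ex L (fun x => (n.+1 < (count_gbs (obs theta x)).*2)%N%:R) <= 4 * alpha.
Proof.
move=> n0 sn.
have nR : 0 < n%:R :> R by rewrite ltr0n.
pose F x := \sum_(i < n | tnth theta i == 0) ((pvalue (obs theta x) i <= alpha)%R%:R : R).
have bI i : bmeas (fun x => (pvalue (obs theta x) i <= alpha)%R%:R : R).
  by apply: bmeas_bool; exact: measurable_pvalue_obs.
have bF : bmeas F by exact: bmeas_sum.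
have mb : dmeas (fun x => (n.+1 < (count_gbs (obs theta x)).*2)%N).
  apply: (dmeas_factor (D := fun x => gbs alpha (obs theta x))).
    exact: (dmeas_obs theta (dmeas_gbs alpha01)).
  by move=> u v E; rewrite -(sum_gbs alpha01 (obs theta u)) E sum_gbs.
apply: (@le_trans _ _ (Ex L (fun x => 4 / n%:R * F x))).
  apply: le_Ex; first exact: (bmeas_comp (fun b : bool => b%:R) mb).
    exact: bmeasZ.
  move=> x; case: ltnP => [big|_]; last first.
    by rewrite mulr_ge0 ?divr_ge0 ?ler0n ?sumr_ge0.
  set y := obs theta x in big *.
  have r0n : ((uphalf n).*2 <= n.+1)%N by lia.
  have cr : (uphalf n <= #|[pred k | (pvalue y k <= thr (uphalf n))%R]|)%N.
    by apply: gbs_count_pvalues => //; lia.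
  have thra : thr (uphalf n) <= alpha.
    apply: le_trans (threshold_le_double alpha01 r0n) _.
    have h : 2 * (uphalf n)%:R <= n.+1%:R :> R by rewrite -natrM mul2n ler_nat.
    rewrite mulrA ler_pdivrMr ?ltr0n//.
    rewrite (_ : _ * (2 * alpha) = alpha * (2 * (uphalf n)%:R)); last by ring.
    by rewrite ler_pM2l.
  pose nulls := [pred k | (tnth theta k == 0) && (pvalue y k <= alpha)].
  pose small := [pred k | pvalue y k <= alpha].
  have nul : (n <= 4 * #|nulls|)%N.
    have : (uphalf n <= #|small|)%N.
      exact: leq_trans cr (card_pvalue_le_mono y thra).
    have : (#|small| <= #|nulls| + #|support_set theta|)%N.
      rewrite -cardUI (leq_trans _ (leq_addr _ _))//.
      apply/subset_leq_card/fintype.subsetP => k; rewrite !inE => ->.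
      by rewrite andbT orbN.
    by lia.
  have -> : F x = #|nulls|%:R.
    rewrite -sum1_card natr_sum /F big_mkcond/= [RHS]big_mkcond/=.
    by apply: eq_bigr => k _; rewrite inE /= -/y; case: eqP => //= _; case: (_ <= _).
  by rewrite mulrAC ler_pdivlMr// mul1r -natrM ler_nat.
rewrite ExZ// /F Ex_sum// mulrAC ler_pdivrMr// -mulrA ler_pM2l//.
apply: (@le_trans _ _ (\sum_(i < n | tnth theta i == 0) alpha)).
  by apply: ler_sum => i /eqP th0; exact: Ex_pvalue_null.
exact: sum_const_le (ltW a0).
Qed.

Lemma Ex_FDP_gbs theta :
  (0 < n)%N -> (4 * #|support_set theta| <= n)%N ->
  Ex L (fun x => FDP theta (gbs alpha (obs theta x))) <= 6 * alpha.
Proof.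
move=> n0 sn.
have mg : dmeas (fun x => gbs alpha (obs theta x)).
  exact: (dmeas_obs theta (dmeas_gbs alpha01)).
have bS i : bmeas (fun x => rejection_share i (gbs alpha (obs theta x))).
  exact: (bmeas_comp (rejection_share i) mg).
have bB : bmeas (fun x => (n.+1 < (count_gbs (obs theta x)).*2)%N%:R : R).
  under eq_fun => x do rewrite -(sum_gbs alpha01 (obs theta x)).
  exact: (bmeas_comp (fun phi : n.-tuple bool =>
    (n.+1 < (\sum_(k < n) tnth phi k).*2)%N%:R) mg).
pose S x := \sum_(i < n | tnth theta i == 0)
   rejection_share i (gbs alpha (obs theta x)).
have bSS : bmeas S by exact: bmeas_sum.
apply: (@le_trans _ _ (Ex L (fun x =>
  S x + (n.+1 < (count_gbs (obs theta x)).*2)%N%:R))).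
  apply: le_Ex; [exact: (bmeas_comp (FDP theta) mg)|exact: bmeasD|move=> x].
  rewrite -(sum_gbs alpha01 (obs theta x)) /S; set phi := gbs alpha _.
  have M0 : 0 < (maxn 1 (\sum_(k < n) tnth phi k))%:R :> R by rewrite ltr0n leq_maxl.
  rewrite /FDP; case: (ltnP n.+1) => big.
    apply: (@le_trans _ _ 1); last by rewrite lerDr sumr_ge0// => i _; exact: rejection_share_ge0.
    rewrite ler_pdivrMr// mul1r ler_nat /false_rejections leq_max; apply/orP; right.
    rewrite big_mkcond/=; apply: leq_sum => i _; by case: ifP.
  rewrite addr0 /false_rejections natr_sum big_distrl/=; apply: ler_sum => i _.
  by rewrite /rejection_share big andbT.
rewrite ExD// (_ : 6 * alpha = 2 * alpha + 4 * alpha); last by ring.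
apply: lerD; last exact: many_rejections_bound.
rewrite /S Ex_sum//.
apply: (@le_trans _ _ (\sum_(i < n | tnth theta i == 0) (2 * alpha / n.+1%:R))).
  by apply: ler_sum => i /eqP; exact: rejection_share_bound.
have an0 : 0 <= 2 * alpha / n.+1%:R :> R by rewrite divr_ge0// mulr_ge0// ltW.
apply: le_trans (sum_const_le _ an0) _.
rewrite mulrAC ler_pdivrMr ?ltr0n//.
by rewrite ler_wpM2l ?ler_nat// mulr_ge0// ltW.
Qed.

End FDPControl.

(** * Lower tail of the number of steps *)

Section Detection.
Context {R : realType} {n : nat}.
Implicit Types (x theta : n.-tuple R) (i j : 'I_n) (c t : R).
Variable L : probability (n.-tuple R) R.
Hypothesis LP : product_law L.

Lemma pvalue_obsE theta x i :
  pvalue (obs theta x) i = 2 * Phibar `|tnth theta i + tnth x i|.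
Proof. by rewrite /pvalue tnth_obs. Qed.

Local Opaque Ex gbs gbs_count pvalue.

Definition pv_ind theta c i x : R := (pvalue (obs theta x) i <= c)%R%:R.

Lemma pv_indE theta c i x : pv_ind theta c i x = (pvalue (obs theta x) i <= c)%R%:R.
Proof. by []. Qed.

Lemma EFin_Ex_pv_ind theta c i : (Ex L (pv_ind theta c i))%:E =
  normal_prob 0 1 [set z : R | 2 * Phibar `|tnth theta i + z| <= c]%R.
Proof. exact: EFin_Ex_pvalue. Qed.

Lemma bmeas_pv_ind theta c i : bmeas (pv_ind theta c i).
Proof. by apply: bmeas_bool; exact: measurable_pvalue_obs. Qed.

Local Opaque pv_ind.

Lemma pv_ind_sqr theta c i x : pv_ind theta c i x * pv_ind theta c i x = pv_ind theta c i x.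
Proof. by rewrite pv_indE -natrM mulnb andbb. Qed.

Lemma Ex_pv_ind_pair theta c i j : i != j ->
  Ex L (fun x => pv_ind theta c i x * pv_ind theta c j x) =
  Ex L (pv_ind theta c i) * Ex L (pv_ind theta c j).
Proof.
move=> ij; apply: EFin_inj.
under eq_Ex => x do rewrite !pv_indE -natrM mulnb.
transitivity (normal_prob 0 1 [set z : R | 2 * Phibar `|tnth theta i + z| <= c]%R *
  normal_prob 0 1 [set z : R | 2 * Phibar `|tnth theta j + z| <= c]%R)%E; last first.
  by rewrite EFinM; congr (_ * _)%E; exact/esym/EFin_Ex_pv_ind.
rewrite EFin_Ex_bool; last first.
  rewrite (_ : [set _ | _] = [set x | pvalue (obs theta x) i <= c] `&`
    [set x | pvalue (obs theta x) j <= c]).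
    by apply: measurableI; exact: measurable_pvalue_obs.
  by apply/seteqP; split => x /= /andP.
rewrite -(product_law_pair LP ij); try exact: measurable_pvalue_set.
congr (L _); apply/seteqP; split => x; rewrite /= !pvalue_obsE.
  by move=> /andP.
by move=> [-> ->].
Qed.

(** Distinct coordinates are uncorrelated, and the variance of an indicator is at
    most its mean. *)
Lemma cov_pv_ind theta c i j :
  Ex L (fun x => (pv_ind theta c i x - Ex L (pv_ind theta c i)) *
                 (pv_ind theta c j x - Ex L (pv_ind theta c j))) <=
  if i == j then Ex L (pv_ind theta c i) else 0.
Proof.
have aux0 (u v : R) : u * v + - v * u + (- u * v + u * v) <= 0 by lra.
have aux1 (u : R) : 0 <= u * u -> u + - u * u + (- u * u + u * u) <= u by lra.
have bi k := bmeas_pv_ind theta c k.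
have [qi Ei] : {v | Ex L (pv_ind theta c i) = v} by eexists.
have [qj Ej] : {v | Ex L (pv_ind theta c j) = v} by eexists.
have q0 : 0 <= qi.
  by rewrite -Ei; apply: Ex_ge0 => x; rewrite pv_indE; exact: ler0n.
rewrite Ei Ej.
have -> : (fun x => (pv_ind theta c i x - qi) * (pv_ind theta c j x - qj)) =
    (fun x => (pv_ind theta c i x * pv_ind theta c j x +
       (- qj) * pv_ind theta c i x) + ((- qi) * pv_ind theta c j x + qi * qj)).
  apply/funext => x.
  by move: (pv_ind _ _ i x) (pv_ind _ _ j x) => u v; ring.
have b1 : bmeas (fun x => pv_ind theta c i x * pv_ind theta c j x) by exact: bmeasM.
have b3 : bmeas (fun x => - qj * pv_ind theta c i x) by exact: bmeasZ.
have b4 : bmeas (fun x => - qi * pv_ind theta c j x) by exact: bmeasZ.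
rewrite ExD; [|exact: bmeasD|by apply: bmeasD => //; exact: bmeas_cst].
rewrite ExD// ExD//; last exact: bmeas_cst.
rewrite Ex_cst !ExZ// Ei Ej.
have [ij|ij] := eqVneq i j; last first.
  by rewrite Ex_pv_ind_pair// Ei Ej aux0.
have -> : qj = qi by rewrite -Ei -Ej ij.
rewrite -ij; under eq_Ex => x do rewrite pv_ind_sqr.
by rewrite Ei; apply: aux1; exact: mulr_ge0.
Qed.

(** Chebyshev's inequality for the number of p-values below [c] in a set of
    coordinates, whose variance is at most its mean by pairwise independence. *)
Lemma count_lower_tail theta c (p : pred 'I_n) (k : R) :
  let m := \sum_(i < n | p i) Ex L (pv_ind theta c i) in
  0 < m -> 2 * k <= m ->
  Ex L (fun x => (\sum_(i < n | p i) pv_ind theta c i x < k)%R%:R) <= 4 / m.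
Proof.
have aux (u m' : R) : 0 < m' -> 2 * k <= m' -> u < k -> m' ^+ 2 <= 4 * (u - m') ^+ 2.
  move=> m0 km uk; have : m' <= 2 * (m' - u) by lra.
  by nra.
move=> m m0 km.
pose q i := Ex L (pv_ind theta c i).
have bi i := bmeas_pv_ind theta c i.
pose D i x := pv_ind theta c i x - q i.
have bD i : bmeas (D i) by apply: bmeasB => //; exact: bmeas_cst.
have bDD i j : bmeas (fun x => D i x * D j x) by exact: bmeasM.
have b2 : bmeas (fun x => \sum_(i < n | p i) \sum_(j < n | p j) D i x * D j x).
  by apply: bmeas_sum => i; exact: bmeas_sum.
have q0 i : 0 <= q i by apply: Ex_ge0 => x; exact: ler0n.
have cov i j := cov_pv_ind theta c i j.
have var : Ex L (fun x => \sum_(i < n | p i) \sum_(j < n | p j) D i x * D j x) <= m.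
  rewrite Ex_sum; last by move=> i; exact: bmeas_sum.
  apply: ler_sum => i pi; rewrite Ex_sum//.
  apply: (@le_trans _ _ (\sum_(j < n | p j) (if i == j then q i else 0))).
    by apply: ler_sum => j _; exact: cov.
  rewrite (bigD1 i)//= eqxx big1 ?addr0// => j /andP[_ ji].
  by rewrite eq_sym (negbTE ji).
have mb : measurable [set x | \sum_(i < n | p i) pv_ind theta c i x < k].
  have [mS _] := bmeas_sum (index_enum 'I_n) p bi.
  rewrite (_ : [set _ | _] =
    (fun x => \sum_(i < n | p i) pv_ind theta c i x) @^-1` `]-oo, k[).
    by rewrite -[X in measurable X]setTI; exact: mS.
  by apply/seteqP; split => x /=; rewrite in_itv.
apply: (@le_trans _ _ (Ex L (fun x => (4 / m ^+ 2) *
  (\sum_(i < n | p i) \sum_(j < n | p j) D i x * D j x)))); last first.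
  rewrite ExZ// (_ : 4 / m = 4 / m ^+ 2 * m); last by field; rewrite lt0r_neq0.
  by rewrite ler_wpM2l// divr_ge0// exprn_ge0// ltW.
apply: le_Ex; [exact: bmeas_bool|exact: bmeasZ|move=> x].
have -> : \sum_(i < n | p i) \sum_(j < n | p j) D i x * D j x =
    (\sum_(i < n | p i) pv_ind theta c i x - m) ^+ 2.
  rewrite expr2 /m -sumrB big_distrl/=; apply: eq_bigr => i _.
  by rewrite big_distrr.
set S := \sum_(i < n | p i) _.
rewrite mulrAC ler_pdivlMr ?exprn_gt0//.
have [Sk|_] := ltP S k; last by rewrite mul0r mulr_ge0// sqr_ge0.
by rewrite mul1r; exact: aux Sk.
Qed.

Variable alpha : R.
Hypothesis alpha01 : 0 < alpha < 1.
Notation thr := (gbs_threshold n alpha).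
Notation count_gbs := (gbs_count alpha).

Lemma sum_half_pow r : \sum_(k < r) (2^-1 : R) ^+ k <= 2.
Proof.
suff -> : \sum_(k < r) (2^-1 : R) ^+ k = 2 - 2 * 2^-1 ^+ r.
  by rewrite gerBl mulr_ge0// exprn_ge0.
elim: r => [|r IH]; first by rewrite big_ord0 expr0; lra.
by rewrite big_ord_recr/= IH exprS; lra.
Qed.

(** The step-down condition must hold at every step [j <= r]. Between two powers
    of two it is implied by a count of at least [2 ^ k.+1] p-values below
    [thr (2 ^ k)], so that Chebyshev's inequality is summed along a geometric
    sequence only. *)
Lemma gbs_count_lower_tail theta (M : R) (r : nat) :
  4 <= M -> (r <= n)%N ->
  (forall k, (2 ^ k <= r)%N -> M * (2 ^ k)%:R <=
    \sum_(i < n | tnth theta i != 0) Ex L (pv_ind theta (thr (2 ^ k)) i)) ->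
  Ex L (fun x => (count_gbs (obs theta x) < r)%N%:R) <= 8 / M.
Proof.
move=> M4 rn HM.
pose N k x := \sum_(i < n | tnth theta i != 0) pv_ind theta (thr (2 ^ k)) i x.
have M0 : 0 < M by lra.
have bN k : bmeas (N k) by apply: bmeas_sum => i; exact: bmeas_pv_ind.
have bE k : bmeas (fun x => (N k x < (2 ^ k.+1)%:R)%R%:R : R).
  apply: bmeas_bool; rewrite (_ : [set _ | _] = N k @^-1` `]-oo, (2 ^ k.+1)%:R[).
    by rewrite -[X in measurable X]setTI; case: (bN k) => mN _; exact: mN.
  by apply/seteqP; split => x /=; rewrite in_itv.
have bG : bmeas (fun x => (count_gbs (obs theta x) < r)%N%:R : R).
  under eq_fun => x do rewrite -(sum_gbs alpha01 (obs theta x)).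
  exact: (bmeas_comp (fun phi : n.-tuple bool =>
    (\sum_(k < n) tnth phi k < r)%N%:R) (dmeas_obs theta (dmeas_gbs alpha01))).
apply: (@le_trans _ _ (Ex L (fun x =>
  \sum_(k < r | (2 ^ k <= r)%N) (N k x < (2 ^ k.+1)%:R)%R%:R))).
  apply: le_Ex => //.
    by apply: bmeas_sum => k; exact: bE.
  move=> x; case: ltnP => [cr|_]; last by rewrite sumr_ge0.
  have [j /andP[j0 jr] jc] : exists2 j, (0 < j <= r)%N &
      (#|[pred k | (pvalue (obs theta x) k <= thr j)%R]| < j)%N.
    apply: contrapT => H; suff : (r <= count_gbs (obs theta x))%N by rewrite leqNgt cr.
    apply/gbs_count_geP; split => // j jr; rewrite leqNgt; apply/negP => jc.
    by apply: H; exists j.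
  pose k := trunc_log 2 j.
  have /andP[kj jk] : (2 ^ k <= j < 2 ^ k.+1)%N by exact: trunc_log_bounds.
  have kr : (k < r)%N by rewrite (leq_trans _ jr)// (leq_trans _ kj)// ltn_expl.
  rewrite (bigD1 (Ordinal kr))/=; last exact: leq_trans jr.
  have -> : (N k x < (2 ^ k.+1)%:R)%R.
    apply: (@le_lt_trans _ _ #|[pred k | (pvalue (obs theta x) k <= thr j)%R]|%:R).
      rewrite /N -sum1_card natr_sum big_mkcond/= [leRHS]big_mkcond/=.
      apply: ler_sum => i _; rewrite inE pv_indE /=.
      have := threshold_mono alpha01 kj (leq_trans jr rn).
      case: eqP => _ /=; first by case: ifP.
      move=> H; have [pH|_] := leP (pvalue (obs theta x) i) (thr (2 ^ k)).
        by rewrite (le_trans pH H).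
      by case: ifP.
    by rewrite ltr_nat (ltn_trans jc).
  by rewrite lerDl sumr_ge0.
rewrite Ex_sum; last by move=> k; exact: bE.
apply: (@le_trans _ _ (\sum_(k < r) (4 / M) * 2^-1 ^+ k)); last first.
  rewrite -big_distrr/= (_ : 8 / M = 4 / M * 2); last by ring.
  by rewrite ler_wpM2l ?sum_half_pow// divr_ge0// ltW.
rewrite [leLHS]big_mkcond/=; apply: ler_sum => k _; case: ifP => [kr|_]; last first.
  by rewrite mulr_ge0 ?divr_ge0 ?exprn_ge0// ltW.
have p0 : 0 < (2 ^ k)%:R :> R by rewrite ltr0n expn_gt0.
have Mk := HM _ kr; have m0 := lt_le_trans (mulr_gt0 M0 p0) Mk.
apply: le_trans (count_lower_tail m0 _) _.
  by apply: le_trans Mk; rewrite expnS natrM mulrA ler_wpM2r ?(ltW p0)//; lra.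
rewrite exprVn -natrX -mulrA -invfM ler_wpM2l// lef_pV2// posrE// mulr_gt0//.
Qed.

End Detection.

(** * Missed signals and the detection boundary *)

Section MissedSignals.
Context {R : realType} {n : nat}.
Implicit Types (x theta : n.-tuple R) (i : 'I_n) (t : R).
Variable L : probability (n.-tuple R) R.
Hypothesis LP : product_law L.
Variable alpha : R.
Hypothesis alpha01 : 0 < alpha < 1.
Notation thr := (gbs_threshold n alpha).
Notation count_gbs := (gbs_count alpha).

(** Outside the event that fewer than [r] steps are made, every signal with
    p-value below [thr r] is detected. *)
Lemma Ex_FNP_gbs theta (s : nat) (M : R) (r : nat) t :
  (0 < s)%N -> 4 <= M -> (0 < r <= n)%N ->
  #|support_set theta| = s ->
  (forall k, (2 ^ k <= r)%N -> M * (2 ^ k)%:R <=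
    \sum_(i < n | tnth theta i != 0) Ex L (pv_ind theta (thr (2 ^ k)) i)) ->
  0 <= t -> 2 * Phibar t = thr r ->
  Ex L (fun x => FNP s theta (gbs alpha (obs theta x))) <=
  8 / M + s%:R^-1 * \sum_(i < n | tnth theta i != 0) Phibar (`|tnth theta i| - t).
Proof.
move=> s0 M4 /andP[r0 rn] cs HM t0 tr.
have sR : 0 < s%:R :> R by rewrite ltr0n.
have mg : dmeas (fun x => gbs alpha (obs theta x)).
  exact: (dmeas_obs theta (dmeas_gbs alpha01)).
have bG : bmeas (fun x => (count_gbs (obs theta x) < r)%N%:R : R).
  under eq_fun => x do rewrite -(sum_gbs alpha01 (obs theta x)).
  exact: (bmeas_comp (fun phi : n.-tuple bool =>
    (\sum_(k < n) tnth phi k < r)%N%:R) mg).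
have b1 i : bmeas (fun x => 1 - pv_ind theta (thr r) i x).
  by apply: bmeasB; [exact: bmeas_cst|exact: bmeas_pv_ind].
have bS : bmeas (fun x => s%:R^-1 *
    \sum_(i < n | tnth theta i != 0) (1 - pv_ind theta (thr r) i x)).
  by apply: bmeasZ; exact: bmeas_sum.
apply: (@le_trans _ _ (Ex L (fun x => (count_gbs (obs theta x) < r)%N%:R +
  s%:R^-1 * \sum_(i < n | tnth theta i != 0) (1 - pv_ind theta (thr r) i x)))).
  apply: le_Ex; [exact: (bmeas_comp (FNP s theta) mg)|exact: bmeasD|move=> x].
  rewrite /FNP (maxn_idPr s0) mulrC /missed_signals.
  have [cr|rc] := ltnP (count_gbs (obs theta x)) r.
    apply: (@le_trans _ _ 1); last first.
      rewrite lerDl mulr_ge0 ?invr_ge0 ?ler0n// sumr_ge0// => i _.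
      by rewrite pv_indE; case: (pvalue _ _ <= _); rewrite ?subrr ?subr0.
    rewrite mulrC ler_pdivrMr// mul1r ler_nat -cs -sum1_card [leqRHS]big_mkcond/=.
    rewrite big_mkcond/=; apply: leq_sum => i _; rewrite inE.
    by case: ifP => // _; exact: leq_subr.
  rewrite add0r ler_wpM2l ?invr_ge0 ?ler0n// natr_sum; apply: ler_sum => i _.
  rewrite (gbs_rejectE alpha01 (obs theta x) i) (leq_trans r0 rc)/= pv_indE.
  have cmono : thr r <= thr (count_gbs (obs theta x)).
    by apply: threshold_mono => //; exact: gbs_count_le.
  have [pr|_] := leP (pvalue (obs theta x) i) (thr r).
    by rewrite (le_trans pr cmono) subnn subrr.
  by rewrite subr0 -[leRHS]/(1%:R) ler_nat leq_subr.
rewrite ExD// lerD//; first exact: gbs_count_lower_tail.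
rewrite ExZ; last exact: bmeas_sum.
rewrite ler_wpM2l ?invr_ge0 ?ler0n// Ex_sum//; apply: ler_sum => i _.
rewrite ExB; [|exact: bmeas_cst|exact: bmeas_pv_ind].
rewrite Ex_cst -(opprB t) PhibarN -[Phi _](subKr 1) lerD2l lerN2.
exact: Ex_pvalue_alt.
Qed.

End MissedSignals.

Section SignalClassSums.
Context {R : realType}.

(** The injection pairing the [a j] with coordinates of [theta] is onto the
    support, since both have [s] elements. *)
Lemma signal_class_sum n s (a : 'I_s -> R) (theta : n.-tuple R) (F : R -> R) :
  (forall j, 0 < a j) -> signal_class a theta ->
  (forall u v, u <= v -> F v <= F u) ->
  \sum_(i < n | tnth theta i != 0) F `|tnth theta i| <= \sum_j F (a j).
Proof.
move=> a0 [cs [f [finj fa]]] Fmono.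
have fsupp j : f j \in support_set theta.
  by rewrite inE -normr_gt0 (lt_le_trans _ (fa j)).
have im : [set f j | j in 'I_s]%SET = support_set theta.
  apply/eqP; rewrite eqEcard card_imset// card_ord cs leqnn andbT.
  by apply/fintype.subsetP => _ /imsetP[j _ ->].
rewrite (eq_bigl (fun i => i \in [set f j | j in 'I_s]%SET)); last first.
  by move=> i; rewrite im inE.
rewrite big_imset/=; last by move=> u v _ _; exact: finj.
by apply: ler_sum => j _; exact: Fmono.
Qed.

Lemma signal_class_card n s (a : 'I_s -> R) (theta : n.-tuple R) (b : R) :
  (forall j, 0 < a j) -> signal_class a theta ->
  (#|[pred j | (b <= a j)%R]| <=
   #|[pred i | (tnth theta i != 0)%R && (b <= `|tnth theta i|)%R]|)%N.
Proof.
move=> a0 [_ [f [finj fa]]]; rewrite -(fintype.card_image finj).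
apply/subset_leq_card/fintype.subsetP => i /fintype.imageP[j]; rewrite !inE => bj ->.
by rewrite -normr_gt0 (lt_le_trans _ (fa j))//= (le_trans bj).
Qed.

(** A signal below [astar n s - C] is missed with probability at least
    [1 - delta / 2]. If these were more than the proportion [1 - delta / 2] of all
    signals, [Lambda] would exceed [1 - delta]. *)
Lemma Lambda_good_count n s (a : 'I_s -> R) (delta C : R) :
  (0 < s)%N -> 0 < delta -> Lambda n a <= 1 - delta -> Phibar C <= delta / 2 ->
  s%:R * (delta / 2) <= #|[pred j | (astar n s - C <= a j)%R]|%:R.
Proof.
move=> s0 d0 La PC; have sR : 0 < s%:R :> R by rewrite ltr0n.
move: La; rewrite /Lambda mulrC ler_pdivrMr// => La.
set G := [pred j | _].
have : \sum_(j < s) (if j \in G then 0 else 1 - delta / 2) <=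
    \sum_(j < s) Phibar (a j - astar n s).
  apply: ler_sum => j _; rewrite inE /=.
  have [_|ja] := leP (astar n s - C) (a j); first exact: Phibar_ge0.
  apply: (@le_trans _ _ (Phibar (- C))); last by apply: Phibar_nonincreasing; lra.
  by rewrite PhibarN; move: PC; rewrite /Phibar; lra.
move=> /le_trans/(_ La).
have -> : \sum_(j < s) (if j \in G then 0 else 1 - delta / 2) =
    \sum_(j < s) ((1 - delta / 2) - (j \in G)%:R * (1 - delta / 2)).
  apply: eq_bigr => j _; case: (_ \in _); first by rewrite mul1r subrr.
  by rewrite mul0r subr0.
rewrite sumrB sumr_const card_ord -big_distrl/= -natr_sum.
have -> : (\sum_(j < s) (j \in G) = #|G|)%N.
  by rewrite -sum1_card [RHS]big_mkcond; apply: eq_bigr => j _; case: (_ \in _).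
rewrite -[_ *+ s]mulr_natr; move: (#|G|%:R) (ler0n R #|G|) => g g0.
by move=> H; nra.
Qed.

End SignalClassSums.

Section Boundary.
Context {R : realType}.

(** Here [y] is the excess over the boundary [as_] of a critical value whose
    square is [as_ ^+ 2 + 2 * H']. To first order [as_ * y] is [H'], and the last
    inequality controls the deviation when [H / as_] is small. *)
Lemma sqrt_gain (as_ C H H' : R) :
  0 < as_ -> 0 <= C <= as_ -> 0 <= H <= H' ->
  let y := Num.sqrt (as_ ^+ 2 + 2 * H') - as_ in
  [/\ 0 <= y, (as_ + y) ^+ 2 = as_ ^+ 2 + 2 * H', y <= H' / as_ &
      H - H / as_ * (C + H / as_ / 2) <= (as_ - C) * y].
Proof.
move=> a0 /andP[C0 Ca] /andP[H0 HH'].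
set u := as_ ^+ 2 + 2 * H'.
have u0 : 0 <= u by rewrite addr_ge0 ?sqr_ge0// mulr_ge0// (le_trans H0).
have h0 : 0 <= H / as_ by rewrite divr_ge0// ltW.
move=> y; have yE : (as_ + y) ^+ 2 = u by rewrite addrC subrK sqr_sqrtr.
have y0 : 0 <= y.
  rewrite subr_ge0 -ler_sqr ?nnegrE ?sqrtr_ge0 ?(ltW a0)// sqr_sqrtr// lerDl.
  by rewrite mulr_ge0// (le_trans H0).
clearbody y; split => //.
  rewrite ler_pdivlMr//; move: yE; rewrite /u sqrrD.
  by have := sqr_ge0 y; lra.
have := h0; set h := H / as_ in h0 *; have HE : H = h * as_.
  by rewrite /h divfK// lt0r_neq0.
move=> _; clearbody h.
have d0 : 0 < as_ + h / 2 by lra.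
pose z := H / (as_ + h / 2).
have zE : z * (as_ + h / 2) = H by rewrite /z divfK// lt0r_neq0.
have z0 : 0 <= z by rewrite divr_ge0// ltW.
clearbody z.
have zh : z <= h.
  rewrite -(ler_pM2r a0) -HE -zE ler_wpM2l//; lra.
(* [z] is a rational lower bound for the square root, exact to second order *)
have zy : z <= y.
  rewrite -(lerD2l as_) -ler_sqr ?nnegrE ?addr_ge0 ?(ltW a0)//.
  rewrite yE /u sqrrD -addrA lerD2l.
  have : z * z <= z * h by rewrite ler_wpM2l.
  by move: zE; rewrite expr2; lra.
apply: (@le_trans _ _ ((as_ - C) * z)); last by rewrite ler_wpM2l// subr_ge0.
rewrite -(ler_pM2r d0) -[leRHS]mulrA zE HE.
have := mulr_ge0 h0 h0; have := mulr_ge0 h0 C0.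
move=> h1 h2; have := mulr_ge0 h1 h0; have := mulr_ge0 h2 h0.
by lra.
Qed.

Lemma astar_sqr (n s : nat) : (0 < s <= n)%N ->
  astar n s ^+ 2 = 2 * ln (n%:R / s%:R) :> R.
Proof.
move=> /andP[s0 sn]; rewrite sqr_sqrtr// mulr_ge0// ln_ge0//.
by rewrite ler_pdivlMr ?ltr0n// mul1r ler_nat.
Qed.

(** The threshold at step [j] is at least of order [j * alpha / n], and [n / s] is
    the exponential of [astar n s ^+ 2 / 2]; only the ratio [s / j], [alpha] and an
    absolute constant are left over. *)
Lemma quantile_le_astar (n s j : nat) (alpha t : R) :
  (0 < s <= n)%N -> (0 < j <= n)%N -> 0 < alpha < 1 -> 0 <= t ->
  t ^+ 2 <= 2 * ln (2 / gbs_threshold n alpha j) ->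
  t ^+ 2 <= astar n s ^+ 2 + 2 * (ln (s%:R / j%:R) + ln (1 / alpha) + ln 4).
Proof.
move=> sn /andP[j0 jn] al t0 /le_trans; apply.
have /andP[s0 s_n] := sn.
have /andP[a0 a1] := al.
have sR : 0 < s%:R :> R by rewrite ltr0n.
have jR : 0 < j%:R :> R by rewrite ltr0n.
have nR : 0 < n%:R :> R by rewrite ltr0n (leq_trans s0).
have nS : 0 < n.+1%:R :> R by rewrite ltr0n.
have c0 : 0 < gbs_threshold n alpha j by rewrite threshold_gt0// j0.
rewrite astar_sqr// -mulrDr ler_wpM2l//.
rewrite -!lnM ?posrE ?mulr_gt0 ?invr_gt0//.
rewrite ler_ln ?posrE ?mulr_gt0 ?invr_gt0//.
have -> : n%:R / s%:R * (s%:R / j%:R * (1 / alpha) * 4) =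
   2 / (j%:R * alpha / (2 * n%:R)) :> R.
  by field; rewrite !lt0r_neq0.
rewrite ler_wpM2l// lef_pV2 ?posrE ?divr_gt0 ?mulr_gt0 ?threshold_den_gt0//.
apply: le_trans (threshold_ge al jn).
rewrite ler_wpM2l ?mulr_ge0 ?(ltW a0)// ?ler0n// lef_pV2 ?posrE ?mulr_gt0//.
by rewrite -natrM ler_nat; lia.
Qed.

End Boundary.

Section MissedSignalsBound.
Context {R : realType}.

(** The procedure is shown to reach step [r], the integer part of
    [s * expR (- (K + 1))]. At a step [j <= r] the critical value is at most
    [as_ + y] with [(as_ + y) ^+ 2 = as_ ^+ 2 + 2 * L' j], and a signal above
    [as_ - C] exceeds it with probability at least [Phibar (y + C)]. Up to
    constants the logarithm of the latter is
    [- L' j + (as_ - (C + 1)) * y], where [- L' j] accounts for the factor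
    [j * alpha / s] and, by [sqrt_gain], the remaining term is at least [A + K].
    The [A] cancels [alpha], and [K] provides the factor [M]. *)
Lemma Ex_FNP_gbs_Lambda (n s : nat) (L : probability (n.-tuple R) R)
    (alpha : R) (a : 'I_s -> R) (theta : n.-tuple R) (delta C M K : R) :
  let as_ := astar n s in let A := ln (1 / alpha) in
  let rho := (A + K + 4) / as_ in
  product_law L -> (0 < s <= n)%N -> 0 < alpha < 1 -> (forall j, 0 < a j) ->
  signal_class a theta ->
  0 < delta -> 0 <= C -> Phibar C <= delta / 2 -> 4 <= M -> 0 <= K ->
  8 * M / (delta * normal_peak 1) * expR ((C + 1) ^+ 2 / 2) <= expR K ->
  0 < as_ -> C + 1 <= as_ -> rho * (C + 1 + rho / 2) <= 1 ->
  expR (K + 1) <= s%:R -> Lambda n a <= 1 - delta ->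
  Ex L (fun x => FNP s theta (gbs alpha (obs theta x))) <=
    8 / M + (Lambda n a + rho).
Proof.
have aux1 (u v w z c : R) : u <= w -> z - c <= v -> u - v <= w - z + c by lra.
have aux2 (b t k l f q h w sq : R) : q + k + 1 - h <= w -> h <= 1 ->
    sq = (b + 2 * (l + q + f)) - b - 2 * w + t ->
  - (l + f) + (k - t / 2) <= - sq / 2 by lra.
have aux3 (u v w k q : R) : u <= k + 1 + w -> v = w + w -> w <= 1 ->
  u + q + v <= q + k + 4 by lra.
move=> as_ A rho LP sn al a0 thc d0 C0 PC M4 K0 HK as0 Cas rho1 sK La.
have /andP[s0 s_n] := sn.
have sR : 0 < s%:R :> R by rewrite ltr0n.
have M0 : 0 < M by lra.
have /andP[al0 al1] := al.
have A0 : 0 <= A.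
  by rewrite ln_ge0// ler_pdivlMr// mul1r ltW.
have k0 : 0 < normal_peak (1 : R) by rewrite normal_peak_gt0// oner_neq0.
have cs : #|support_set theta| = s by case: thc.
pose e := expR (- (K + 1)) : R.
have e0 : 0 < e by exact: expR_gt0.
have e1 : e <= 1 by rewrite -[leRHS]expR0 ler_expR; lra.
pose r := Num.truncn (s%:R * e).
have /andP[re er] : r%:R <= s%:R * e < r.+1%:R.
  by apply: truncn_itv; rewrite mulr_ge0// ltW.
clearbody r.
have r0 : (0 < r)%N.
  rewrite -ltnS -(@ltr_nat R) (le_lt_trans _ er)//.
  by rewrite /e expRN ler_pdivlMr ?expR_gt0// mul1r.
have rR : 0 < r%:R :> R by rewrite ltr0n.
have re2 : s%:R * e <= 2 * r%:R.
  apply: le_trans (ltW er) _.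
  by rewrite -natrM ler_nat mul2n -addnn -addn1 leq_add2l.
have rs : (r <= s)%N.
  by rewrite -(@ler_nat R) (le_trans re)// ler_piMr// ltW.
have rn : (r <= n)%N by exact: leq_trans s_n.
have ln40 : 0 <= ln 4 :> R by rewrite ln_ge0//; lra.
pose H := A + K + 1.
have H0 : 0 <= H by rewrite /H; lra.
pose L' (j : nat) : R := ln (s%:R / j%:R) + A + ln 4.
have HL' j : (0 < j <= r)%N -> H <= L' j.
  move=> /andP[j0 jr]; have jR : 0 < j%:R :> R by rewrite ltr0n.
  suff : K + 1 <= ln (s%:R / j%:R) by rewrite /H /L'; lra.
  rewrite -[leLHS]expRK ler_ln ?posrE ?expR_gt0 ?divr_gt0//.
  rewrite ler_pdivlMr// mulrC -ler_pdivlMr ?expR_gt0// -expRN.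
  by apply: le_trans re; rewrite ler_nat.
have C1 : 0 <= C + 1 <= as_ by apply/andP; split => //; lra.
have Hh : H / as_ * (C + 1 + H / as_ / 2) <= 1.
  apply: le_trans rho1.
  have h0 : 0 <= H / as_ by rewrite divr_ge0// ltW.
  have hr : H / as_ <= rho.
    by rewrite ler_wpM2r ?invr_ge0 ?(ltW as0)// /H; lra.
  apply: ler_pM => //; first by rewrite addr_ge0//; lra.
  by lra.
have quant j : (0 < j <= r)%N -> exists t,
    [/\ 0 <= t, 2 * Phibar t = gbs_threshold n alpha j &
        t <= Num.sqrt (as_ ^+ 2 + 2 * L' j)].
  move=> /andP[j0 jr]; have jn : (0 < j <= n)%N by rewrite j0 (leq_trans jr).
  have [t [t0 t2 tc]] : exists t, [/\ 0 <= t, t ^+ 2 <= 2 * ln (2 / gbs_threshold n alpha j)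
      & 2 * Phibar t = gbs_threshold n alpha j].
    by apply: Phibar_quantile; rewrite threshold_gt0// threshold_lt1.
  exists t; split => //; rewrite -(ger0_norm t0) -sqrtr_sqr ler_wsqrtr//.
  exact: quantile_le_astar.
have [t [t0 tc tu]] := quant r (introT andP (conj r0 (leqnn r))).
apply: le_trans (Ex_FNP_gbs LP al s0 M4 (introT andP (conj r0 rn)) cs _ t0 tc) _.
  move=> k kr; set j := (2 ^ k)%N.
  have j0 : (0 < j)%N by rewrite expn_gt0.
  have jR : 0 < j%:R :> R by rewrite ltr0n.
  have jr : (0 < j <= r)%N by rewrite j0.
  have [tj [tj0 tjc tju]] := quant j jr.
  have HH : 0 <= H <= L' j by rewrite H0 HL'.
  have := sqrt_gain as0 C1 HH; set y := _ - as_ => -[y0 yE _ yg].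
  have lb i : as_ - C <= `|tnth theta i| ->
      2 * M * j%:R / (delta * s%:R) <= Ex L (pv_ind theta (gbs_threshold n alpha j) i).
    move=> Ci; apply: le_trans (Ex_pvalue_alt LP theta i tj0 tjc).
    apply: (@le_trans _ _ (Phibar (y + C))); last first.
      by apply: Phibar_nonincreasing; exact: aux1.
    have yC : 0 <= y + C by exact: addr_ge0.
    apply: le_trans (Phibar_ge_exp yC).
    apply: (@le_trans _ _ (normal_peak 1 * (j%:R / (4 * s%:R) *
        expR (K - (C + 1) ^+ 2 / 2)))); last first.
      rewrite ler_wpM2l ?(ltW k0)//.
      have -> : j%:R / (4 * s%:R) = expR (- (ln (s%:R / j%:R) + ln 4)) :> R.
        rewrite -lnM ?posrE ?divr_gt0// expRN lnK ?posrE ?mulr_gt0 ?divr_gt0 ?invr_gt0//.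
        by field; rewrite !lt0r_neq0.
      rewrite -expRD ler_expR.
      have : (y + C + 1) ^+ 2 = (as_ + y) ^+ 2 - as_ ^+ 2 - 2 * ((as_ - (C + 1)) * y) + (C + 1) ^+ 2.
        by ring.
      by rewrite yE => sqE; exact: aux2 yg Hh sqE.
    rewrite expRB.
    have : 8 * M / (delta * normal_peak 1) <= expR K / expR ((C + 1) ^+ 2 / 2).
      by rewrite ler_pdivlMr ?expR_gt0.
    move: (expR K / _) => u Hu.
    have -> : normal_peak 1 * (j%:R / (4 * s%:R) * u) = (normal_peak 1 * j%:R / (4 * s%:R)) * u.
      by ring.
    apply: le_trans (ler_wpM2l _ Hu); last by rewrite divr_ge0 ?mulr_ge0 ?(ltW k0)// ltW.
    rewrite le_eqVlt; apply/orP; left; apply/eqP; field.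
    by rewrite !lt0r_neq0.
  pose G := [pred i | (tnth theta i != 0) && (as_ - C <= `|tnth theta i|)].
  have cG : s%:R * (delta / 2) <= #|G|%:R :> R.
    apply: le_trans (Lambda_good_count s0 d0 La PC) _.
    by rewrite ler_nat; exact: signal_class_card.
  apply: (@le_trans _ _ (\sum_(i < n | G i) 2 * M * j%:R / (delta * s%:R))).
    rewrite sumr_const -[leRHS]mulr_natr.
    have -> : M * j%:R = 2 * M * j%:R / (delta * s%:R) * (s%:R * (delta / 2)).
      by field; rewrite !lt0r_neq0.
    by rewrite ler_wpM2l// divr_ge0// ?mulr_ge0// ltW.
  rewrite [leLHS]big_mkcond [leRHS]big_mkcond /=; apply: ler_sum => i _.
  case: (tnth theta i != 0) => //=; case: ifP => [Ci|_]; first exact: lb.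
  by apply: Ex_ge0 => x; rewrite pv_indE ler0n.
rewrite lerD2l.
have tas : t <= as_ + rho.
  have HH : 0 <= H <= L' r by rewrite H0 HL'// r0 leqnn.
  have := sqrt_gain as0 C1 HH; set y := _ - as_ => -[_ _ yL _].
  have : L' r <= A + K + 4.
    have : ln (s%:R / r%:R) <= K + 1 + ln 2 :> R.
      rewrite -[X in X + _]expRK -lnM ?posrE ?expR_gt0//.
      rewrite ler_ln ?posrE ?divr_gt0 ?mulr_gt0 ?expR_gt0//.
      rewrite ler_pdivrMr// -ler_pdivrMl ?mulr_gt0 ?expR_gt0//.
      rewrite invfM -expRN -/e.
      by move: re2; rewrite mulrAC [e * _]mulrC; lra.
    have : ln 4 = ln 2 + ln 2 :> R by rewrite -lnM ?posrE//; congr ln; ring.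
    have : ln 2 <= 1 :> R by have := @le_ln1Dx R 1; rewrite -natr1; apply; lra.
    by move=> h1 h2 h3; exact: aux3 h3 h2 h1.
  have as1 : 0 <= as_^-1 by rewrite invr_ge0 ltW.
  move=> /(ler_wpM2r as1); rewrite -/rho; move: yL tu; rewrite /y.
  by move=> h1 h2 h3; apply: le_trans h2 _; rewrite -lerBlDl; exact: le_trans h1 h3.
rewrite mulrC ler_pdivrMr//.
apply: le_trans (signal_class_sum (F := fun u => Phibar (u - t)) a0 thc _) _.
  by move=> u v uv; apply: Phibar_nonincreasing; lra.
have -> : (Lambda n a + rho) * s%:R = \sum_(j < s) (Phibar (a j - as_) + rho).
  rewrite big_split/= sumr_const card_ord -[rho *+ s]mulr_natr mulrDl /Lambda.
  by rewrite mulrAC mulVf ?mul1r// lt0r_neq0.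
have rho0 : 0 <= rho by rewrite divr_ge0 ?(ltW as0)// addr_ge0// addr_ge0.
apply: ler_sum => j _.
apply: (@le_trans _ _ (Phibar (a j - as_ - rho))).
  by apply: Phibar_nonincreasing; lra.
rewrite -lerBlDl; apply: le_trans (Phibar_lip _) _; first by rewrite gerBl.
by rewrite opprB addrC subrK.
Qed.

End MissedSignalsBound.

(** * Lower bound: one block *)

Section BlockBound.
Context {R : realType} {n : nat}.
Implicit Types (x y theta : n.-tuple R) (i : 'I_n).
Variable L : probability (n.-tuple R) R.
Hypothesis LP : product_law L.

(** Truncation of the observation at [tau] bounds the likelihood ratio by
    [expR (tau ^+ 2 / 2)], whatever the shift [a]. *)
Definition trunc_lr (a tau z : R) : R := (z <= tau)%R%:R * expR (a * z - a ^+ 2 / 2).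

Lemma trunc_lr_ge0 a tau z : 0 <= trunc_lr a tau z.
Proof. by rewrite mulr_ge0// expR_ge0. Qed.

Lemma trunc_lr_le a tau z : 0 <= a -> trunc_lr a tau z <= expR (tau ^+ 2 / 2).
Proof.
move=> a0; rewrite /trunc_lr; have [zt|_] := leP z tau; last by rewrite mul0r expR_ge0.
rewrite mul1r ler_expR; have := ler_wpM2l a0 zt; have := sqr_ge0 (a - tau).
by rewrite sqrrB; lra.
Qed.

Lemma measurable_coord_le i (tau : R) : measurable [set x | tnth x i <= tau].
Proof.
rewrite (_ : [set _ | _] = (fun x => tnth x i) @^-1` `]-oo, tau]).
  by rewrite -[X in measurable X]setTI; exact: measurable_tnth.
by apply/seteqP; split => x /=; rewrite in_itv.
Qed.

Lemma bmeas_trunc_lr a tau i : 0 <= a -> bmeas (fun x => trunc_lr a tau (tnth x i)).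
Proof.
move=> a0; split; last first.
  exists (expR (tau ^+ 2 / 2)) => x.
  by rewrite ger0_norm ?trunc_lr_ge0// trunc_lr_le.
apply: measurable_funM; first by have [] := bmeas_bool R (measurable_coord_le i tau).
apply: measurableT_comp => //; apply: measurable_funB => //.
by apply: measurable_funM => //; exact: measurable_tnth.
Qed.

Lemma Ex_shift_truncated theta i (a tau : R) (f : n.-tuple R -> R) :
  tnth theta i = 0 -> 0 <= a -> bmeas f -> (forall y, 0 <= f y) ->
  Ex L (fun x => f (obs (upd theta i a) x) * (tnth (obs (upd theta i a) x) i <= tau)%R%:R) =
  Ex L (fun x => f (obs theta x) * trunc_lr a tau (tnth x i)).
Proof.
move=> th0 a0 bf f0.
have bI : bmeas (fun x => (tnth x i <= tau)%R%:R : R).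
  exact: bmeas_bool (measurable_coord_le i tau).
have bH : bmeas (fun x => f (obs theta x) * (tnth x i <= tau)%R%:R).
  by apply: bmeasM => //; exact: bmeas_obs.
pose H x := (f (obs theta x) * (tnth x i <= tau)%R%:R)%:E.
have mH : measurable_fun setT H by apply/measurable_EFinP; case: bH.
have H0 x : (0 <= H x)%E by rewrite lee_fin mulr_ge0.
apply: EFin_inj; rewrite EFin_Ex; last first.
  exact: (bmeas_obs (upd theta i a) (bmeasM bf bI)).
rewrite EFin_Ex; last by apply: bmeasM; [exact: bmeas_obs|exact: bmeas_trunc_lr].
have := ge0_integral_shift_coord LP i a mH H0.
rewrite (_ : (\int[L]_x H (upd x i (tnth x i + a)%R))%E =
  (\int[L]_x (f (obs (upd theta i a) x) * (tnth (obs (upd theta i a) x) i <= tau)%R%:R)%:E)%E).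
  move=> ->; apply: eq_integral => x _.
  by rewrite /H -EFinM /trunc_lr mulrA.
apply: eq_integral => x _; rewrite /H; congr ((f _ * _%:R)%:E).
  apply: eq_from_tnth => j; rewrite !tnth_obs !tnth_upd.
  by case: eqP => // ->; rewrite th0 add0r addrC.
by rewrite tnth_obs !tnth_upd eqxx addrC.
Qed.

Variables (m : nat) (e : 'I_m -> 'I_n) (theta : n.-tuple R) (a : R).
Hypothesis theta0 : forall k, tnth theta (e k) = 0.
Hypothesis a0 : 0 <= a.
Variable f : 'I_m -> n.-tuple R -> R.
Hypothesis bf : forall k, bmeas (f k).
Hypothesis f01 : forall k y, 0 <= f k y <= 1.
Notation th k := (upd theta (e k) a).

(** One block with a single signal at a uniform position. A detection with
    observation below [tau] has truncated likelihood ratio [trunc_lr]. Let [W]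
    be the sum of these ratios over the block. Either [W <= m * delta], and such
    detections contribute at most [delta] to the detection probability, or
    [1 <= W / (m * delta)], and summing the ratios turns the null law into the
    mixture, under which the number of rejections is measured. *)
Lemma block_detection_bound (tau delta : R) : (0 < m)%N -> 0 < delta ->
  \sum_k Ex L (fun x => f k (obs (th k) x)) <=
  m%:R * Phibar (tau - a) + m%:R * delta +
  expR (tau ^+ 2 / 2) / (m%:R * delta) *
    \sum_k Ex L (fun x => \sum_l f l (obs (th k) x)).
Proof.
move=> m0 d0; have mR : 0 < m%:R :> R by rewrite ltr0n.
set B := expR _; have B0 : 0 < B by exact: expR_gt0.
have md0 : 0 < m%:R * delta by exact: mulr_gt0.
have f0 k y : 0 <= f k y by case/andP: (f01 k y).
have f1 k y : f k y <= 1 by case/andP: (f01 k y).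
pose N y := \sum_l f l y.
have bN : bmeas N by exact: bmeas_sum.
have N0 y : 0 <= N y by exact: sumr_ge0.
pose w k x := trunc_lr a tau (tnth x (e k)).
have bw k : bmeas (w k) by exact: bmeas_trunc_lr.
have bfo k t : bmeas (fun x => f k (obs t x)) by exact: bmeas_obs.
have bNo t : bmeas (fun x => N (obs t x)) by exact: bmeas_obs.
have bI k : bmeas (fun y => (tnth y (e k) <= tau)%R%:R : R).
  exact: bmeas_bool (measurable_coord_le (e k) tau).
have bIo k : bmeas (fun x => (tnth (obs (th k) x) (e k) <= tau)%R%:R : R).
  exact: (bmeas_obs (th k) (bI k)).
have split1 k : Ex L (fun x => f k (obs (th k) x)) <=
    Phibar (tau - a) + Ex L (fun x => f k (obs theta x) * w k x).
  rewrite -(Ex_shift_truncated tau (theta0 k) a0 (bf k) (f0 k)).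
  have bJ : bmeas (fun x => (tau < tnth (obs (th k) x) (e k))%R%:R : R).
    under eq_fun => x do rewrite ltNge.
    exact: (bmeas_comp (fun b : bool => (~~ b)%:R)
      (dmeas_obs (th k) (dmeas_bool (measurable_coord_le (e k) tau)))).
  have -> : Phibar (tau - a) = Ex L (fun x => (tau < tnth (obs (th k) x) (e k))%R%:R).
    have mz : measurable `]tau - a, +oo[ by [].
    apply: EFin_inj; rewrite -normal_tailo -(product_law_marginal LP (e k) mz).
    rewrite EFin_Ex_bool; last first.
      rewrite (_ : [set _ | _] = ~` [set x | tnth (obs (th k) x) (e k) <= tau]).
        apply: measurableC; rewrite -[X in measurable X]setTI.
        exact: (measurable_obs (th k) measurableT (measurable_coord_le (e k) tau)).
      by apply/seteqP; split => x /=; rewrite ltNge => /negP.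
    congr (L _); apply/seteqP; split => x /=;
      by rewrite in_itv/= andbT tnth_obs tnth_upd eqxx ltrBlDl.
  rewrite -ExD//; last exact: bmeasM.
  apply: le_Ex => //; first by apply: bmeasD => //; exact: bmeasM.
  move=> x; have [_|_] := leP (tnth (obs (th k) x) (e k)) tau.
    by rewrite add0r mulr1.
  by rewrite mulr0 addr0.
apply: (@le_trans _ _ (\sum_k (Phibar (tau - a) + Ex L (fun x => f k (obs theta x) * w k x)))).
  by apply: ler_sum => k _; exact: split1.
rewrite big_split/= sumr_const card_ord -[_ *+ m]mulr_natl -addrA lerD2l.
have bfw k : bmeas (fun x => f k (obs theta x) * w k x) by exact: bmeasM.
have bW : bmeas (fun x => \sum_k N (obs theta x) * w k x).
  by apply: bmeas_sum => k; exact: bmeasM.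
rewrite -Ex_sum//.
apply: (@le_trans _ _ (Ex L (fun x => m%:R * delta +
    B / (m%:R * delta) * \sum_k N (obs theta x) * w k x))).
  apply: le_Ex; first exact: bmeas_sum.
    by apply: bmeasD; [exact: bmeas_cst|exact: bmeasZ].
  move=> x; have w0 k : 0 <= w k x by exact: trunc_lr_ge0.
  have wB k : w k x <= B by exact: trunc_lr_le.
  rewrite -big_distrr/=; set W := \sum_k w k x.
  have W0 : 0 <= W by exact: sumr_ge0.
  have [Wd|Wd] := leP W (m%:R * delta).
    apply: (@le_trans _ _ W).
      by apply: ler_sum => k _; rewrite ler_piMl.
    by rewrite (le_trans Wd)// lerDl !mulr_ge0 ?invr_ge0 ?(ltW B0)// ltW.
  apply: (@le_trans _ _ (B * N (obs theta x))).
    rewrite /N big_distrr/=; apply: ler_sum => k _.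
    by rewrite mulrC ler_wpM2r.
  apply: (@le_trans _ _ (B / (m%:R * delta) * (N (obs theta x) * W))); last first.
    by rewrite lerDr ltW.
  rewrite mulrACA ler_peMr ?mulr_ge0 ?(ltW B0)//.
  by rewrite mulrC ler_pdivlMr// mul1r ltW.
rewrite ExD; [|exact: bmeas_cst|exact: bmeasZ].
rewrite Ex_cst lerD2l ExZ// ler_wpM2l ?divr_ge0 ?(ltW B0) ?(ltW md0)//.
rewrite Ex_sum; last by move=> k; exact: bmeasM.
apply: ler_sum => k _; rewrite -(Ex_shift_truncated tau (theta0 k) a0 bN N0).
apply: le_Ex; [exact: bmeasM|exact: bNo|move=> x].
by rewrite -/(N _) ler_piMr//; case: (tnth _ _ <= _).
Qed.

End BlockBound.

(** * Lower bound: the block prior *)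

Section FiniteAverage.
Context {R : realType} {s m : nat}.
Implicit Types (f : {ffun 'I_s -> 'I_m}).

Definition ffupd f (j : 'I_s) (k : 'I_m) : {ffun 'I_s -> 'I_m} :=
  [ffun j' => if j' == j then k else f j'].

(** Resampling one coordinate of a uniform function: [(f, k)] is sent to
    [(ffupd f j k, f j)] by an involution. *)
Lemma sum_ffupd (j : 'I_s) (F : {ffun 'I_s -> 'I_m} -> R) :
  \sum_f \sum_k F (ffupd f j k) = m%:R * \sum_f F f.
Proof.
pose h (p : {ffun 'I_s -> 'I_m} * 'I_m) := (ffupd p.1 j p.2, p.1 j).
have hK : involutive h.
  move=> [f k]; rewrite /h /= ffunE eqxx; congr (_, _).
  by apply/ffunP => j'; rewrite !ffunE; case: eqP => // ->.
rewrite pair_big/= (reindex_inj (inv_inj hK))/=.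
transitivity (\sum_(p : {ffun 'I_s -> 'I_m} * 'I_m) F p.1).
  apply: eq_bigr => -[f k] _ /=; congr F.
  by apply/ffunP => j'; rewrite !ffunE; case: eqP => // ->.
rewrite -(pair_big xpredT xpredT (fun f (k : 'I_m) => F f))/=.
under eq_bigr do rewrite sumr_const card_ord.
by rewrite sumrMnl mulr_natl.
Qed.

End FiniteAverage.

Section BlockPrior.
Context {R : realType} {n s m : nat}.
Hypothesis smn : (s * m <= n)%N.
Variable a : 'I_s -> R.
Hypothesis a0 : forall j, 0 < a j.
Implicit Types (f : {ffun 'I_s -> 'I_m}) (j : 'I_s) (k : 'I_m) (i : 'I_n).

Lemma block_index_subproof j k : (j * m + k < n)%N.
Proof.
apply: leq_trans smn; apply: (@leq_trans (j.+1 * m)); last by rewrite leq_mul2r ltn_ord orbT.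
by rewrite mulSn addnC ltn_add2r.
Qed.

Definition block_index j k : 'I_n := Ordinal (block_index_subproof j k).

Lemma block_index_inj j k j' k' :
  block_index j k = block_index j' k' -> j = j' /\ k = k'.
Proof.
move=> /(congr1 val)/= E.
have m0 : (0 < m)%N by apply: leq_ltn_trans (ltn_ord k).
have jj : j = j' :> nat.
  have := congr1 (fun z => z %/ m)%N E.
  by rewrite !divnMDl// !divn_small// !addn0.
by split; apply: val_inj => //=; move: E; rewrite jj => /addnI.
Qed.

Definition block_theta f : n.-tuple R :=
  [tuple \sum_j (if i == block_index j (f j) then a j else 0) | i < n].

Lemma tnth_block_theta f j k :
  tnth (block_theta f) (block_index j k) = if k == f j then a j else 0.
Proof.
rewrite tnth_mktuple (bigD1 j)//= big1 ?addr0 => [|j' j'j].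
  case: eqP => [/block_index_inj[_ ->]|E]; first by rewrite eqxx.
  by case: eqP => // kf; rewrite kf in E.
by case: eqP => // /block_index_inj[jj' _]; rewrite jj' eqxx in j'j.
Qed.

Lemma tnth_block_theta_out f i :
  (forall j, i != block_index j (f j)) -> tnth (block_theta f) i = 0.
Proof.
by move=> H; rewrite tnth_mktuple big1// => j _; rewrite (negbTE (H j)).
Qed.

Lemma block_theta_neq0 f i :
  (tnth (block_theta f) i != 0) = [exists j, i == block_index j (f j)].
Proof.
apply/idP/existsP => [|[j /eqP ->]]; last first.
  by rewrite tnth_block_theta eqxx lt0r_neq0.
apply: contraNP => H; apply/eqP/tnth_block_theta_out => j.
by apply/negP => ij; apply: H; exists j.
Qed.

Lemma position_inj f : injective (fun j => block_index j (f j)).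
Proof. by move=> j j' /block_index_inj[]. Qed.

Lemma support_block_theta f :
  support_set (block_theta f) = [set block_index j (f j) | j in 'I_s]%SET.
Proof.
apply/setP => i; rewrite inE block_theta_neq0.
by apply/existsP/imsetP => [[j /eqP ->]|[j _ ->]]; exists j.
Qed.

Lemma card_support_block_theta f : #|support_set (block_theta f)| = s.
Proof.
by rewrite support_block_theta card_imset ?card_ord//; exact: position_inj.
Qed.

Lemma block_theta_class f : signal_class a (block_theta f).
Proof.
split; first exact: card_support_block_theta.
exists (fun j => block_index j (f j)); split; first exact: position_inj.
by move=> j; rewrite tnth_block_theta eqxx ger0_norm// ltW.
Qed.

Lemma sum_block_support f (F : 'I_n -> nat) :
  (\sum_(i < n | tnth (block_theta f) i != 0%R) F i =
   \sum_j F (block_index j (f j)))%N.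
Proof.
rewrite (eq_bigl (fun i => i \in support_set (block_theta f))); last first.
  by move=> i; rewrite inE.
rewrite support_block_theta big_imset//= => u v _ _; exact: position_inj.
Qed.

(** Erasing the signal of block [j] and putting it back at [k] stays within the
    support of the prior; the erased vector is the null version of the block. *)
Lemma block_theta_upd f j k :
  upd (upd (block_theta f) (block_index j (f j)) 0) (block_index j k) (a j) =
  block_theta (ffupd f j k).
Proof.
apply: eq_from_tnth => i; rewrite !tnth_upd.
case: eqP => [->|ik]; first by rewrite tnth_block_theta ffunE !eqxx.
case: eqP => [iE|ifj].
  rewrite iE tnth_block_theta ffunE eqxx; case: eqP => // E.
  by case: ik; rewrite iE E.
rewrite !tnth_mktuple; apply: eq_bigr => j' _; rewrite ffunE.
case: (eqVneq j' j) => [->|//].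
by case: eqP => // _; case: eqP.
Qed.

Lemma block_theta_erased f j k :
  tnth (upd (block_theta f) (block_index j (f j)) 0) (block_index j k) = 0.
Proof.
rewrite tnth_upd; case: eqP => // E; rewrite tnth_block_theta.
by case: eqP => // kf; rewrite kf in E.
Qed.

End BlockPrior.

(** * Lower bound: averaging over the prior *)

Section LowerBound.
Context {R : realType} {n s : nat}.
Variable L : probability (n.-tuple R) R.
Hypothesis LP : product_law L.
Variable a : 'I_s -> R.
Hypothesis a0 : forall j, 0 < a j.
Variable phi : n.-tuple R -> n.-tuple bool.
Hypothesis mphi : dmeas phi.
Notation m := (n %/ s)%N.

Lemma blocks_fit : (s * m <= n)%N.
Proof. by rewrite mulnC leq_trunc_div. Qed.

Notation bidx := (block_index blocks_fit).
Notation btheta := (block_theta blocks_fit a).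

Lemma rejections_split (theta : n.-tuple R) (b : n.-tuple bool) :
  (\sum_(i < n) tnth b i = false_rejections theta b +
   \sum_(i < n | tnth theta i != 0%R) tnth b i)%N.
Proof. by rewrite (bigID (fun i => tnth theta i == 0)). Qed.

Lemma missed_signalsE (theta : n.-tuple R) (b : n.-tuple bool) :
  (missed_signals theta b + \sum_(i < n | tnth theta i != 0%R) tnth b i =
   #|support_set theta|)%N.
Proof.
rewrite /missed_signals -big_split/= -sum1_card; apply: eq_big => [i|i _].
  by rewrite inE.
by case: (tnth b i).
Qed.

(** Rejections are only counted when there are at most [K * s] of them. Beyond
    that many, the false discovery proportion is at least [1 - 1 / K], which is
    as bad as missing every signal. *)
Lemma loss_ge_linear (K : R) (theta : n.-tuple R) (b : n.-tuple bool) :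
  (0 < s)%N -> 0 < K -> #|support_set theta| = s ->
  1 - K^-1 - s%:R^-1 * (\sum_(i < n | tnth theta i != 0)
     (tnth b i && ((\sum_(k < n) tnth b k)%N%:R <= K * s%:R))%:R) <=
  FDP theta b + FNP s theta b.
Proof.
move=> s0 K0 cs; have sR : 0 < s%:R :> R by rewrite ltr0n.
have K1 : 0 <= K^-1 by rewrite invr_ge0 ltW.
have FDP0 : 0 <= FDP theta b :> R by rewrite divr_ge0 ?ler0n.
have FNP0 : 0 <= FNP s theta b :> R by rewrite divr_ge0 ?ler0n.
have [le|gt] := leP ((\sum_(k < n) tnth b k)%N%:R) (K * s%:R); last first.
  rewrite big1 ?mulr0 ?subr0; last by move=> i _; rewrite andbF.
  apply: (@le_trans _ _ (FDP theta b)); last by rewrite lerDl.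
  set r := (\sum_(k < n) tnth b k)%N in gt *.
  have rR : 0 < r%:R :> R by apply: lt_trans gt; exact: mulr_gt0.
  have r0 : (0 < r)%N by rewrite -(@ltr0n R).
  rewrite /FDP -/r (maxn_idPr r0) ler_pdivlMr// mulrBl mul1r.
  have rle : (r <= false_rejections theta b + s)%N.
    rewrite /r (rejections_split theta) leq_add2l -cs.
    by rewrite -(missed_signalsE theta b) leq_addl.
  have : r%:R <= (false_rejections theta b)%:R + s%:R :> R by rewrite -natrD ler_nat.
  have : s%:R <= K^-1 * r%:R :> R by rewrite ler_pdivlMl// ltW.
  by lra.
rewrite (eq_bigr (fun i => (tnth b i)%:R)); last by move=> i _; rewrite andbT.
rewrite -natr_sum; have := missed_signalsE theta b; rewrite cs.
set TP := (\sum_(i < n | _) _)%N => E.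
have -> : FNP s theta b = 1 - s%:R^-1 * TP%:R :> R.
  rewrite /FNP (maxn_idPr s0) -[in LHS](addnK TP (missed_signals theta b)) E.
  rewrite natrB; last by rewrite -E leq_addl.
  by rewrite mulrBl divff ?lt0r_neq0// mulrC.
by lra.
Qed.

Notation loss theta x := (FDP theta (phi (obs theta x)) + FNP s theta (phi (obs theta x))).

(** Some position function is at least as bad as the average one. Summing
    [block_detection_bound] over the blocks makes the budget of [K * s] rejections
    appear under the law of the mixture itself, where it holds surely. *)
Lemma exists_hard_theta (K delta tau : R) :
  (0 < s <= n)%N -> 0 < K -> 0 < delta ->
  exists2 theta, signal_class a theta &
    1 - s%:R^-1 * \sum_j Phibar (tau - a j) - delta - K^-1
      - expR (tau ^+ 2 / 2) / m%:R * (K / delta) <= Ex L (fun x => loss theta x).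
Proof.
move=> /andP[s0 sn] K0 d0.
have m0 : (0 < m)%N by rewrite divn_gt0.
have sR : 0 < s%:R :> R by rewrite ltr0n.
have mR : 0 < m%:R :> R by rewrite ltr0n.
set B := expR _; have B0 : 0 < B by exact: expR_gt0.
pose dec i (b : n.-tuple bool) : R :=
  (tnth b i && ((\sum_(k < n) tnth b k)%N%:R <= K * s%:R))%:R.
have bdec i : bmeas (fun y => dec i (phi y)) by exact: (bmeas_comp (dec i) mphi).
have dec01 i b : 0 <= dec i b <= 1 by rewrite ler0n lern1 leq_b1.
pose TP (f : {ffun 'I_s -> 'I_m}) (j : 'I_s) :=
  Ex L (fun x => dec (bidx j (f j)) (phi (obs (btheta f) x))).
pose RJ (f : {ffun 'I_s -> 'I_m}) (j : 'I_s) :=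
  Ex L (fun x => \sum_k dec (bidx j k) (phi (obs (btheta f) x))).
have bRJ f j : bmeas (fun x => \sum_k dec (bidx j k) (phi (obs (btheta f) x))).
  apply: bmeas_sum => k.
  exact: (bmeas_obs (btheta f) (bdec (bidx j k))).
pose nF : R := #|{ffun 'I_s -> 'I_m}|%:R.
have nF0 : 0 < nF.
  by rewrite ltr0n; apply/card_gt0P; exists [ffun=> Ordinal m0].
(* each block, averaged over the position of its signal *)
have block j : \sum_f TP f j <= nF * (Phibar (tau - a j) + delta) +
    B / (m%:R * delta) * \sum_f RJ f j.
  have H f := block_detection_bound LP (e := bidx j)
    (block_theta_erased blocks_fit a f j) (ltW (a0 j))
    (fun k => bdec (bidx j k)) (fun k y => dec01 (bidx j k) (phi y)) tau m0 d0.
  have {}H : \sum_f \sum_k TP (ffupd f j k) j <=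
      \sum_f (m%:R * Phibar (tau - a j) + m%:R * delta +
        B / (m%:R * delta) * \sum_k RJ (ffupd f j k) j).
    apply: ler_sum => f _; move: (H f); rewrite -/B.
    under eq_bigr => k _ do rewrite block_theta_upd.
    under [in X in _ <= _ + _ * X]eq_bigr => k _ do rewrite block_theta_upd.
    congr (_ <= _); apply: eq_bigr => k _; rewrite /TP ffunE eqxx.
    by [].
  rewrite -(ler_pM2l mR) -(sum_ffupd j (fun f => TP f j)) (le_trans H)//.
  rewrite big_split/= sumr_const -/nF -big_distrr/= (sum_ffupd j (fun f => RJ f j)).
  rewrite -[_ *+ _]mulr_natl -/nF le_eqVlt; apply/orP; left; apply/eqP; ring.
have rej f : \sum_j RJ f j <= K * s%:R.
  rewrite -Ex_sum; last by move=> j; exact: bRJ.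
  apply: (@le_trans _ _ (Ex L (fun=> K * s%:R))); last by rewrite Ex_cst.
  apply: le_Ex; [by apply: bmeas_sum => j; exact: bRJ|exact: bmeas_cst|move=> x].
  set b := phi _.
  rewrite pair_big/=.
  have [le|gt] := leP ((\sum_(k < n) tnth b k)%N%:R) (K * s%:R); last first.
    rewrite big1 ?mulr_ge0 ?(ltW K0)// => -[j k] _; rewrite /dec.
    by rewrite leNgt gt andbF.
  apply: le_trans le; rewrite natr_sum.
  have inj2 : injective (fun p : 'I_s * 'I_m => bidx p.1 p.2).
    by move=> [j k] [j' k'] /block_index_inj/= [-> ->].
  apply: (@le_trans _ _ (\sum_(p : 'I_s * 'I_m) (tnth b (bidx p.1 p.2))%:R)).
    by apply: ler_sum => p _; rewrite /dec ler_nat; case: (tnth b _) => //=; exact: leq_b1.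
  rewrite -(big_imset (h := fun p : 'I_s * 'I_m => bidx p.1 p.2) (fun i => (tnth b i)%:R))/=.
    rewrite [leLHS]big_mkcond; apply: ler_sum => i _; by case: ifP.
  by move=> p q _ _; exact: inj2.
pose c : R := \sum_j (Phibar (tau - a j) + delta) + B / (m%:R * delta) * (K * s%:R).
have avg : \sum_f \sum_j TP f j <= nF * c.
  rewrite exchange_big/=.
  apply: (@le_trans _ _ (\sum_j (nF * (Phibar (tau - a j) + delta) +
      B / (m%:R * delta) * \sum_f RJ f j))).
    by apply: ler_sum => j _; exact: block.
  rewrite big_split/= -big_distrr/= -big_distrr/= exchange_big/= /c mulrDr lerD2l.
  rewrite mulrCA ler_wpM2l ?divr_ge0 ?mulr_ge0 ?(ltW B0) ?(ltW d0)//.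
  apply: (@le_trans _ _ (\sum_(f : {ffun 'I_s -> 'I_m}) (K * s%:R))).
    by apply: ler_sum => f _; exact: rej.
  by rewrite sumr_const -[leLHS]mulr_natl.
have [f fc] : exists f, \sum_j TP f j <= c.
  apply: contrapT => /forallNP H.
  suff : nF * c < \sum_f \sum_j TP f j by rewrite ltNge avg.
  have -> : nF * c = \sum_(f : {ffun 'I_s -> 'I_m}) c by rewrite sumr_const mulr_natl.
  apply: ltr_sum => [|f _]; last by rewrite ltNge; apply/negP; exact: H.
  by apply/hasP; exists [ffun=> Ordinal m0]; rewrite ?mem_index_enum.
exists (btheta f); first exact: block_theta_class.
have cs := card_support_block_theta blocks_fit a0 f.
pose S x := \sum_j dec (bidx j (f j)) (phi (obs (btheta f) x)).
have bS : bmeas S.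
  apply: bmeas_sum => j; exact: (bmeas_obs (btheta f) (bdec _)).
apply: (@le_trans _ _ (Ex L (fun x => (1 - K^-1) - s%:R^-1 * S x))).
  rewrite ExB; [|exact: bmeas_cst|exact: bmeasZ].
  rewrite Ex_cst ExZ// /S Ex_sum; last first.
    by move=> j; exact: (bmeas_obs (btheta f) (bdec _)).
  have : s%:R^-1 * \sum_j TP f j <= s%:R^-1 * c by rewrite ler_wpM2l ?invr_ge0 ?ler0n.
  have -> : s%:R^-1 * c = s%:R^-1 * (\sum_j Phibar (tau - a j)) + delta + B / m%:R * (K / delta).
    rewrite /c big_split/= sumr_const card_ord -[delta *+ s]mulr_natl.
    by field; rewrite !lt0r_neq0.
  rewrite -[X in _ -> _ <= _ - _ * X]/(\sum_j TP f j).
  move: (s%:R^-1 * \sum_j TP f j) (s%:R^-1 * \sum_j Phibar _) (B / _ * _) => u v w.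
  by lra.
apply: le_Ex.
- by apply: bmeasB; [exact: bmeas_cst|exact: bmeasZ].
- apply: (bmeas_comp (fun b => FDP (btheta f) b + FNP s (btheta f) b)).
  exact: (dmeas_obs (btheta f) mphi).
- move=> x; apply: le_trans (loss_ge_linear _ s0 K0 cs).
  rewrite lerD2l lerN2 ler_wpM2l ?invr_ge0 ?ler0n// /S.
  rewrite -natr_sum -natr_sum ler_nat; apply: eq_leq.
  exact: (sum_block_support blocks_fit a0).
Qed.

End LowerBound.

Section LowerBoundLambda.
Context {R : realType}.

(** The square of the boundary satisfies [expR (astar n s ^+ 2 / 2) = n / s], and
    rounding [n / s] down loses at most a factor two. *)
Lemma expR_astar_ratio (n s : nat) (eta : R) : (0 < s <= n)%N ->
  expR ((astar n s - eta) ^+ 2 / 2) / (n %/ s)%N%:R <=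
  2 * expR (eta ^+ 2 / 2 - eta * astar n s).
Proof.
move=> sn; have /andP[s0 s_n] := sn.
have sR : 0 < s%:R :> R by rewrite ltr0n.
have nR : 0 < n%:R :> R by rewrite ltr0n (leq_trans s0).
have m0 : (0 < n %/ s)%N by rewrite divn_gt0.
have mR : 0 < (n %/ s)%N%:R :> R by rewrite ltr0n.
rewrite ler_pdivrMr// sqrrB (astar_sqr sn).
have -> : (2 * ln (n%:R / s%:R) - astar n s * eta *+ 2 + eta ^+ 2) / 2 =
    ln (n%:R / s%:R) + (eta ^+ 2 / 2 - eta * astar n s) by field.
rewrite expRD lnK ?posrE ?divr_gt0// [leRHS]mulrAC ler_wpM2r ?expR_ge0//.
rewrite ler_pdivrMr// -!natrM ler_nat.
by have := ltn_ceil n s0; move: m0 => /(leq_add (leqnn (n %/ s))); nia.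
Qed.

Lemma hard_theta_Lambda (n s : nat) (L : probability (n.-tuple R) R)
    (a : 'I_s -> R) (phi : n.-tuple R -> n.-tuple bool) (K delta eta : R) :
  product_law L -> (forall j, 0 < a j) -> dmeas phi -> (0 < s <= n)%N ->
  0 < K -> 0 < delta -> 0 <= eta ->
  exists2 theta, signal_class a theta &
    Lambda n a - eta - delta - K^-1
      - 2 * expR (eta ^+ 2 / 2 - eta * astar n s) * (K / delta) <=
    Ex L (fun x => FDP theta (phi (obs theta x)) + FNP s theta (phi (obs theta x))).
Proof.
move=> LP a0 mphi sn K0 d0 eta0.
have [theta thc H] := exists_hard_theta LP a0 mphi (astar n s - eta) sn K0 d0.
exists theta => //; apply: le_trans H.
have sR : 0 < s%:R :> R by case/andP: sn; rewrite ltr0n.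
have h1 := ler_wpM2r (ltW (divr_gt0 K0 d0)) (expR_astar_ratio eta sn).
have h2 : Lambda n a - eta <= 1 - s%:R^-1 * \sum_j Phibar (astar n s - eta - a j).
  have -> : 1 - s%:R^-1 * \sum_j Phibar (astar n s - eta - a j) =
      s%:R^-1 * \sum_j (1 - Phibar (astar n s - eta - a j)).
    rewrite [in RHS]sumrB sumr_const card_ord mulrBr -[1 *+ s]/(s%:R) mulVf//.
    by rewrite lt0r_neq0.
  have -> : Lambda n a - eta = s%:R^-1 * \sum_j (Phibar (a j - astar n s) - eta).
    rewrite [in RHS]sumrB sumr_const card_ord mulrBr -[eta *+ s]mulr_natl mulKf//.
    by rewrite lt0r_neq0.
  rewrite ler_wpM2l ?invr_ge0 ?(ltW sR)//; apply: ler_sum => j _.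
  have -> : 1 - Phibar (astar n s - eta - a j) = Phibar (a j - astar n s + eta).
    rewrite /Phibar subKr -/(Phibar _) -PhibarN; congr Phibar; ring.
  have := @Phibar_lip R (a j - astar n s) (a j - astar n s + eta).
  by move: (Phibar _) (Phibar _) => u v; lra.
move: h1 h2; move: (Lambda _ _) (s%:R^-1 * _) (_ * (K / delta)) (_ * (K / delta)) => u v w z.
by lra.
Qed.

End LowerBoundLambda.

(** * From the sample space to tuples *)

Section NoiseLaw.
Context {R : realType} {d : measure_display} {T : measurableType d}.
Variables (P : probability T R) (n : nat) (eps : 'I_n -> {RV P >-> R}).
Hypothesis iid : iid_std_normal eps.

Definition noise (w : T) : n.-tuple R := [tuple eps i w | i < n].

Lemma measurable_noise : measurable_fun setT noise.
Proof.
apply/measurable_fun_tnthP => i.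
rewrite (_ : _ \o _ = eps i); first exact: measurable_funPT.
by apply/funext => w /=; rewrite tnth_mktuple.
Qed.

Definition noise_mfun : {mfun T >-> n.-tuple R} :=
  @mfun_Sub _ _ T (n.-tuple R) _ (mem_set measurable_noise).

Definition noise_law : probability (n.-tuple R) R := distribution P noise_mfun.

Lemma noise_law_product : product_law noise_law.
Proof.
move=> B mB; case: iid => ind law.
transitivity (P (\bigcap_(i in [set` [set: 'I_n]%SET]) (eps i @^-1` B i))).
  congr (P _); apply/seteqP; split => w /=.
    by move=> H i _; have := H i; rewrite tnth_mktuple.
  by move=> H i; rewrite tnth_mktuple; apply: H; rewrite /= inE.
rewrite ind//; apply: eq_big => [i|i _]; first by rewrite inE.
exact: law.
Qed.

Lemma riskE (s : nat) (phi : n.-tuple R -> n.-tuple bool) (theta : n.-tuple R) :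
  dmeas phi ->
  risk eps s phi theta = (Ex noise_law
    (fun x => FDP theta (phi (obs theta x)) + FNP s theta (phi (obs theta x))))%:E.
Proof.
move=> mphi.
pose F x : R := FDP theta (phi (obs theta x)) + FNP s theta (phi (obs theta x)).
have bF : bmeas F.
  apply: (bmeas_comp (fun b => FDP theta b + FNP s theta b)).
  exact: (dmeas_obs theta mphi).
rewrite EFin_Ex// /risk unlock.
transitivity (\int[P]_w ((EFin \o F) \o noise_mfun) w)%E.
  apply: eq_integral => w _ /=; rewrite /F.
  have -> // : observation eps theta w = obs theta (noise w).
  by apply: eq_from_tnth => i; rewrite !tnth_mktuple.
apply/esym/ge0_integral_distribution.
  by apply/measurable_EFinP; case: bF.
by move=> x; rewrite lee_fin addr_ge0// divr_ge0.
Qed.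

End NoiseLaw.

(** * Asymptotics *)

Section RiskBounds.
Context {R : realType}.

Lemma FDP_ge0 n (theta : n.-tuple R) b : 0 <= FDP theta b :> R.
Proof. by rewrite divr_ge0. Qed.

Lemma FNP_ge0 n s (theta : n.-tuple R) b : 0 <= FNP s theta b :> R.
Proof. by rewrite divr_ge0. Qed.

Lemma FDP_le1 n (theta : n.-tuple R) b : FDP theta b <= 1 :> R.
Proof.
rewrite ler_pdivrMr ?ltr0n ?leq_maxl// mul1r ler_nat leq_max; apply/orP; right.
by rewrite (rejections_split theta) leq_addr.
Qed.

Lemma FNP_le1 n s (theta : n.-tuple R) b :
  #|support_set theta| = s -> FNP s theta b <= 1 :> R.
Proof.
move=> cs; rewrite ler_pdivrMr ?ltr0n ?leq_maxl// mul1r ler_nat leq_max.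
by apply/orP; right; rewrite -cs -(missed_signalsE theta b) leq_addr.
Qed.

Variables (n s : nat) (L : probability (n.-tuple R) R) (a : 'I_s -> R).
Hypothesis LP : product_law L.
Hypothesis sn : (0 < s <= n)%N.
Hypothesis a0 : forall j, 0 < a j.

Lemma Ex_loss_le2 theta (phi : n.-tuple R -> n.-tuple bool) :
  signal_class a theta -> dmeas phi ->
  Ex L (fun x => FDP theta (phi (obs theta x)) + FNP s theta (phi (obs theta x))) <= 2.
Proof.
move=> [cs _] mphi; rewrite -(Ex_cst L (2 : R)); apply: le_Ex.
- apply: (bmeas_comp (fun b => FDP theta b + FNP s theta b)).
  exact: (dmeas_obs theta mphi).
- exact: bmeas_cst.
- move=> x; have := FDP_le1 theta (phi (obs theta x)).
  have := FNP_le1 (phi (obs theta x)) cs.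
  by move: (FDP _ _) (FNP _ _ _) => u v; lra.
Qed.

(** When [Lambda n a > 1 - delta], missing every signal costs at most [delta] more
    than [Lambda n a]. *)
Lemma Ex_loss_gbs theta (alpha delta C M K : R) :
  let rho := (ln (1 / alpha) + K + 4) / astar n s in
  0 < alpha < 1 -> signal_class a theta -> (4 * s <= n)%N ->
  0 < delta -> 0 <= C -> Phibar C <= delta / 2 -> 4 <= M -> 0 <= K ->
  8 * M / (delta * normal_peak 1) * expR ((C + 1) ^+ 2 / 2) <= expR K ->
  0 < (astar n s : R) -> C + 1 <= astar n s -> rho * (C + 1 + rho / 2) <= 1 ->
  expR (K + 1) <= s%:R ->
  Ex L (fun x => FDP theta (gbs alpha (obs theta x)) +
                 FNP s theta (gbs alpha (obs theta x))) <=
    Lambda n a + (6 * alpha + 8 / M + rho + delta).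
Proof.
move=> rho al thc s4 d0 C0 PC M4 K0 HK as0 Cas rho1 sK.
have cs : #|support_set theta| = s by case: thc.
have n0 : (0 < n)%N by case/andP: sn => s0; exact: leq_trans.
have mg := dmeas_obs theta (dmeas_gbs al).
have bD : bmeas (fun x => FDP theta (gbs alpha (obs theta x)) : R).
  exact: (bmeas_comp (FDP theta) mg).
have bN : bmeas (fun x => FNP s theta (gbs alpha (obs theta x)) : R).
  exact: (bmeas_comp (FNP s theta) mg).
rewrite ExD//.
have hD : Ex L (fun x => FDP theta (gbs alpha (obs theta x))) <= 6 * alpha.
  by apply: Ex_FDP_gbs => //; rewrite cs.
have A0 : 0 <= ln (1 / alpha).
  by case/andP: al => al0 al1; rewrite ln_ge0// ler_pdivlMr// mul1r ltW.
have rho0 : 0 <= rho by rewrite divr_ge0 ?(ltW as0)// addr_ge0// addr_ge0.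
have M8 : 0 <= 8 / M by rewrite divr_ge0//; lra.
have [La|La] := leP (Lambda n a) (1 - delta).
  have hN := Ex_FNP_gbs_Lambda LP sn al a0 thc d0 C0 PC M4 K0 HK as0 Cas rho1 sK La.
  apply: le_trans (lerD hD hN) _; rewrite -/rho.
  by clearbody rho; lra.
have hN : Ex L (fun x => FNP s theta (gbs alpha (obs theta x))) <= 1.
  rewrite -(Ex_cst L (1 : R)); apply: le_Ex => //; first exact: bmeas_cst.
  by move=> x; exact: FNP_le1.
apply: le_trans (lerD hD hN) _; clearbody rho; lra.
Qed.

End RiskBounds.

Section Asymptotics.
Context {R : realType}.
Variables (s : nat -> nat) (alpha : nat -> R).
Hypothesis s_bounds : forall n, (0 < n)%N -> (0 < s n <= n)%N.
Hypothesis alpha_bounds : forall n, (0 < n)%N -> 0 < alpha n < 1.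
Hypothesis s_infty : s @ \oo --> \oo.
Hypothesis ns_infty : (n%:R / (s n)%:R : R) @[n --> \oo] --> +oo.
Hypothesis alpha_0 : alpha @ \oo --> (0 : R).
Hypothesis log_alpha : (fun n => ln (1 / alpha n)) =o_\oo
               (fun n => Num.sqrt (ln (n%:R / (s n)%:R))).

Lemma astar_infty (X : R) : \forall n \near \oo, X <= astar n (s n).
Proof.
have : \forall n \near \oo, expR (X ^+ 2) <= n%:R / (s n)%:R.
  by move/cvgryPge : ns_infty; apply.
apply: filterS => n H; apply: le_trans (ler_norm X) _.
rewrite -sqrtr_sqr ler_wsqrtr//.
have : X ^+ 2 <= ln (n%:R / (s n)%:R).
  rewrite -[leLHS]expRK ler_ln ?posrE ?expR_gt0//.
  exact: lt_le_trans (expR_gt0 _) H.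
by have := sqr_ge0 X; lra.
Qed.

Lemma s_ge (X : R) : \forall n \near \oo, X <= (s n)%:R.
Proof.
have : \forall n \near \oo, ((Num.truncn `|X|).+1 <= s n)%N.
  by move/cvgnyPge : s_infty; apply.
apply: filterS => n H; apply: le_trans (ler_norm X) _.
apply: (@le_trans _ _ (Num.truncn `|X|).+1%:R); last by rewrite ler_nat.
by apply: ltW; have /andP[] := truncn_itv (normr_ge0 X).
Qed.

(** The boundary dominates the square root in the hypothesis. When the logarithm
    of [n / s n] is negative both square roots vanish. *)
Lemma log_alpha_le (c : R) : 0 < c ->
  \forall n \near \oo, ln (1 / alpha n) <= c * astar n (s n).
Proof.
move=> c0; have /eqoP/(_ _ c0) := log_alpha.
apply: filterS => n H; apply: le_trans (ler_norm _) _; apply: le_trans H _.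
rewrite ler_wpM2l ?(ltW c0)// ger0_norm ?sqrtr_ge0// /astar.
have [l0|l0] := leP 0 (ln (n%:R / (s n)%:R) : R).
  by rewrite ler_wsqrtr//; lra.
by rewrite ler0_sqrtr ?sqrtr_ge0// ltW.
Qed.

(** The constants are fixed in the order [delta], [C], [M], [K], [rho0], each
    depending on the previous ones, before [n] is taken large. *)
Lemma upper_bound_near (ep : R) : 0 < ep -> \forall n \near \oo,
  forall (L : probability (n.-tuple R) R) (a : 'I_(s n) -> R) theta,
    product_law L -> (forall j, 0 < a j) -> signal_class a theta ->
    Ex L (fun x => FDP theta (gbs (alpha n) (obs theta x)) +
                   FNP (s n) theta (gbs (alpha n) (obs theta x))) <=
    Lambda n a + ep.
Proof.
move=> ep0.
pose delta := Num.min (ep / 4) 2^-1.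
have d0 : 0 < delta by rewrite lt_min divr_gt0//= invr_gt0.
have de : delta <= ep / 4 by rewrite ge_min lexx.
have d1 : delta < 1.
  by apply: (@le_lt_trans _ _ 2^-1); [rewrite ge_min lexx orbT|lra].
clearbody delta.
have [C [C0 _ PC]] := Phibar_quantile (introT andP (conj d0 d1)).
have {}PC : Phibar C <= delta / 2 by move: PC; lra.
pose M := Num.max 4 (32 / ep).
have M4 : 4 <= M by rewrite le_max lexx.
have M8 : 8 / M <= ep / 4.
  have M0 : 0 < M by lra.
  have : 32 / ep <= M by rewrite le_max lexx orbT.
  by rewrite ler_pdivrMr// => H; rewrite ler_pdivrMr//; move: H; lra.
clearbody M.
have k0 : 0 < normal_peak (1 : R) by rewrite normal_peak_gt0// oner_neq0.
have [K K0 HK] : exists2 K, 0 <= K &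
    8 * M / (delta * normal_peak 1) * expR ((C + 1) ^+ 2 / 2) <= expR K.
  exists (8 * M / (delta * normal_peak 1) * expR ((C + 1) ^+ 2 / 2)).
    rewrite mulr_ge0 ?expR_ge0// divr_ge0//; first by lra.
    by rewrite mulr_ge0// ltW.
  by apply: le_trans (expR_ge1Dx _); rewrite lerDr.
pose rho0 := Num.min (C + 2)^-1 (ep / 4).
have C2 : 0 < (C + 2)^-1 by rewrite invr_gt0; lra.
have rho00 : 0 < rho0 by rewrite lt_min C2 divr_gt0.
have rhoe : rho0 <= ep / 4 by rewrite ge_min lexx orbT.
have rhoC : rho0 * (C + 2) <= 1.
  rewrite -ler_pdivlMr ?div1r; last by lra.
  by rewrite ge_min lexx.
have rho2 : rho0 <= 2.
  have : (C + 2)^-1 <= 2^-1 by rewrite lef_pV2 ?posrE; lra.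
  have : rho0 <= (C + 2)^-1 by rewrite ge_min lexx.
  by lra.
clearbody rho0.
have C1 : 0 < C + 1 by lra.
have aux1 (u v k r : R) : u <= r / 2 * v -> k + 4 <= v * (r / 2) ->
  u + k + 4 <= r * v by lra.
have aux2 (c r r' : R) : 0 <= c -> 0 <= r -> r <= r' -> r' <= 2 ->
  0 <= c + 1 + r / 2 /\ c + 1 + r / 2 <= c + 2 by move=> *; split; lra.
have aux3 (u v w z : R) : u <= ep / 4 -> v <= ep / 4 -> w <= ep / 4 ->
  z <= ep / 4 -> u + v + w + z <= ep by lra.
near=> n => L a theta LP a0 thc.
have n0 : (0 < n)%N by near: n; exists 1%N.
have sn := s_bounds n0.
have as1 : C + 1 <= astar n (s n) by near: n; exact: astar_infty.
have as2 : (K + 4) / (rho0 / 2) <= astar n (s n) by near: n; exact: astar_infty.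
have asl : ln (1 / alpha n) <= rho0 / 2 * astar n (s n).
  by near: n; apply: log_alpha_le; rewrite divr_gt0.
have sK : expR (K + 1) <= (s n)%:R by near: n; exact: s_ge.
have s4 : (4 * s n <= n)%N.
  rewrite -(ler_nat R) natrM; have /andP[s0 _] := sn.
  by rewrite -ler_pdivlMr ?ltr0n//; near: n; move/cvgryPge : ns_infty; apply.
have al6 : 6 * alpha n <= ep / 4.
  rewrite -ler_pdivlMl//.
  by near: n; apply: (cvgr_le 0 alpha_0); rewrite mulr_gt0 ?divr_gt0 ?invr_gt0.
have as0 : 0 < (astar n (s n) : R) by exact: lt_le_trans C1 as1.
have A0 : 0 <= ln (1 / alpha n).
  case/andP: (alpha_bounds n0) => al0 al1.
  by rewrite ln_ge0// ler_pdivlMr// mul1r ltW.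
set rho := (ln (1 / alpha n) + K + 4) / astar n (s n).
have rho_ge0 : 0 <= rho by rewrite divr_ge0 ?(ltW as0)// addr_ge0// addr_ge0.
have rho_le : rho <= rho0.
  rewrite ler_pdivrMr//; move: as2; rewrite ler_pdivrMr ?divr_gt0//.
  exact: aux1.
have rhoC1 : rho * (C + 1 + rho / 2) <= 1.
  have [h1 h2] := aux2 _ _ _ C0 rho_ge0 rho_le rho2.
  by apply: le_trans rhoC; exact: ler_pM.
have := Ex_loss_gbs LP sn a0 (alpha_bounds n0) thc s4 d0 C0 PC M4 K0 HK as0 as1 rhoC1 sK.
move=> /le_trans; apply; rewrite lerD2l -/rho.
exact: aux3 al6 M8 (le_trans rho_le rhoe) de.
Unshelve. all: by end_near. Qed.

(** A quarter of [ep] goes to each of the four losses of [hard_theta_Lambda], with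
    [eta], [delta] and [K^-1] all equal to [ep / 4]. *)
Lemma lower_bound_near (ep : R) : 0 < ep -> \forall n \near \oo,
  forall (L : probability (n.-tuple R) R) (a : 'I_(s n) -> R) phi,
    product_law L -> (forall j, 0 < a j) -> dmeas phi ->
    exists2 theta, signal_class a theta &
      Lambda n a - ep <=
      Ex L (fun x => FDP theta (phi (obs theta x)) +
                     FNP (s n) theta (phi (obs theta x))).
Proof.
move=> ep0.
pose e4 := ep / 4; have e40 : 0 < e4 by rewrite divr_gt0.
pose D := 2 * (e4^-1 / e4) / e4.
have D0 : 0 < D by rewrite !(mulr_gt0, invr_gt0).
near=> n => L a phi LP a0 mphi.
have n0 : (0 < n)%N by near: n; exists 1%N.
have sn := s_bounds n0.
(* from this size of the boundary on, the exponential is below [expR (- D)], and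
   [D <= expR D] *)
have as1 : (e4 ^+ 2 / 2 + D) / e4 <= astar n (s n) by near: n; exact: astar_infty.
have K0 : 0 < e4^-1 by rewrite invr_gt0.
have [theta thc H] := hard_theta_Lambda LP a0 mphi sn K0 e40 (ltW e40).
exists theta => //; apply: le_trans H; rewrite invrK.
suff : 2 * expR (e4 ^+ 2 / 2 - e4 * astar n (s n)) * (e4^-1 / e4) <= e4.
  by rewrite {3}/e4; move: (Lambda _ _) (_ * (_ / e4)) => u v; rewrite /e4; lra.
set E := expR _.
have : E <= D^-1.
  apply: (@le_trans _ _ (expR (- D))).
    rewrite ler_expR; move: as1; rewrite ler_pdivrMr//.
    by move: (astar _ _) => v; lra.
  rewrite expRN lef_pV2 ?posrE ?expR_gt0//.
  by have := expR_ge1Dx D; lra.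
rewrite -(ler_pM2r D0) mulVf ?lt0r_neq0// /D => ED.
rewrite -[leRHS]mul1r -ler_pdivrMr//.
by apply: le_trans ED; rewrite le_eqVlt; apply/orP; left; apply/eqP; ring.
Unshelve. all: by end_near. Qed.

End Asymptotics.

(** * Maximal and minimax risks *)

Lemma measurable_gbs (R : realType) (n : nat) (alpha : R) : 0 < alpha < 1 ->
  measurable_fun setT (gbs alpha : n.-tuple R -> n.-tuple bool).
Proof.
move=> al; apply/measurable_fun_tnthP => i _ Y mY; rewrite setTI.
have := dmeas_setP (fun b : n.-tuple bool => `[< Y (tnth b i) >]) (dmeas_gbs al).
by congr measurable; apply/seteqP; split => x /= /asboolP.
Qed.

Lemma dmeas_procedure (R : realType) (n : nat) (phi : n.-tuple R -> n.-tuple bool) :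
  measurable_fun setT phi -> dmeas phi.
Proof.
move=> /measurable_fun_tnthP mphi t.
rewrite (_ : phi @^-1` [set t] =
    \bigcap_(i in [set: 'I_n]) ((fun x => tnth (phi x) i) @^-1` [set tnth t i])); last first.
  apply/seteqP; split => [x /= <- //|x /= H].
  by apply: eq_from_tnth => i; exact: H.
apply: fin_bigcap_measurable => // i _.
by rewrite -[X in measurable X]setTI; exact: mphi.
Qed.

(** Blocks of length one suffice. *)
Lemma signal_class_nonempty (R : realType) (n s : nat) (a : 'I_s -> R) :
  (0 < s <= n)%N -> (forall j, 0 < a j) -> exists theta : n.-tuple R, signal_class a theta.
Proof.
move=> /andP[s0 sn] a0.
have sn' : (s * 1 <= n)%N by rewrite muln1.
by exists (block_theta sn' a [ffun=> ord0]); exact: block_theta_class.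
Qed.

Section SupInf.
Context {R : realType} {d : measure_display} {T : measurableType d}.
Variables (P : probability T R) (n s : nat) (eps : 'I_n -> {RV P >-> R}).
Variable a : 'I_s -> R.
Hypothesis sn : (0 < s <= n)%N.
Hypothesis a0 : forall j, 0 < a j.
Local Open Scope ereal_scope.

Lemma risk_ge0 (phi : n.-tuple R -> n.-tuple bool) theta : 0 <= risk eps s phi theta.
Proof.
by apply: expectation_ge0 => w; rewrite addr_ge0// (FDP_ge0, FNP_ge0).
Qed.

Lemma max_risk_ge0 (phi : n.-tuple R -> n.-tuple bool) : 0 <= max_risk eps a phi.
Proof.
have [theta thc] := signal_class_nonempty sn a0.
by apply: le_trans (risk_ge0 phi theta) _; apply: ereal_sup_ubound; exists theta.
Qed.

Lemma max_risk_fin (phi : n.-tuple R -> n.-tuple bool) : dmeas phi ->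
  max_risk eps a phi \is a fin_num.
Proof.
move=> mphi; apply/fin_real/andP; split.
  by apply: lt_le_trans (max_risk_ge0 phi); exact: ltNyr.
apply: (@le_lt_trans _ _ 2%:E); last exact: ltry.
apply: ge_ereal_sup => _ [theta thc <-].
by rewrite riskE// lee_fin; exact: (Ex_loss_le2 (noise_law eps) thc mphi).
Qed.

Lemma minimax_risk_ge0 : 0 <= minimax_risk eps a.
Proof. by apply: le_ereal_inf_tmp => _ [phi _ <-]; exact: max_risk_ge0. Qed.

Lemma minimax_risk_le (phi : n.-tuple R -> n.-tuple bool) :
  measurable_fun setT phi -> minimax_risk eps a <= max_risk eps a phi.
Proof. by move=> mphi; apply: ereal_inf_lbound; exists phi. Qed.

End SupInf.


Theorem theorem4 (R : realType)
  (d : nat -> measure_display) (Omega : forall n, measurableType (d n))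
  (P : forall n, probability (Omega n) R)
  (eps : forall n, 'I_n -> {RV (P n) >-> R})
  (s : nat -> nat) (alpha : nat -> R) (a : forall n, 'I_(s n) -> R)
  (eps_iid : forall n, (0 < n)%N -> iid_std_normal (eps n))
  (s_bounds : forall n, (0 < n)%N -> (0 < s n <= n)%N)
  (alpha_bounds : forall n, (0 < n)%N -> 0 < alpha n < 1)
  (a_pos : forall n, (0 < n)%N -> forall j, 0 < a n j)
  (s_infty : s @ \oo --> \oo)
  (ns_infty : (n%:R / (s n)%:R : R) @[n --> \oo] --> +oo)
  (alpha_0 : alpha @ \oo --> (0 : R))
  (log_alpha : (fun n => ln (1 / alpha n)) =o_\oo
               (fun n => Num.sqrt (ln (n%:R / (s n)%:R)))) :
  (exists e : nat -> R, e @ \oo --> (0 : R) /\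
     forall n, (0 < n)%N ->
       (max_risk (eps n) (a n) (gbs (alpha n)) <=
          (Lambda n (a n))%:E + (e n)%:E)%E) /\
  (exists e : nat -> R, e @ \oo --> (0 : R) /\
     forall n, (0 < n)%N ->
       max_risk (eps n) (a n) (gbs (alpha n)) =
         (minimax_risk (eps n) (a n) + (e n)%:E)%E).
Proof.
have up : exists e : nat -> R, e @ \oo --> (0 : R) /\
    forall n, (0 < n)%N ->
      (max_risk (eps n) (a n) (gbs (alpha n)) <=
         (Lambda n (a n))%:E + (e n)%:E)%E.
  exists (fun n => Num.max 0 (fine (max_risk (eps n) (a n) (gbs (alpha n))) -
    Lambda n (a n))); split.
    apply/cvgrPdist_le => ep ep0; near=> n.
    have n0 : (0 < n)%N by near: n; exists 1%N.
    have mg : dmeas (gbs (alpha n) : n.-tuple R -> n.-tuple bool).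
      exact: dmeas_gbs (alpha_bounds n n0).
    have fin := max_risk_fin (eps n) (s_bounds n n0) (a_pos n n0) mg.
    rewrite sub0r normrN ger0_norm ?le_max ?lexx// ge_max (ltW ep0)/=.
    rewrite lerBlDl -lee_fin fineK//.
    apply: ge_ereal_sup => _ [theta thc <-].
    rewrite (riskE (eps n) (s n) theta mg) lee_fin.
    have LP := noise_law_product (eps_iid n n0).
    suff H : forall (L : probability (n.-tuple R) R) (an : 'I_(s n) -> R) theta,
      product_law L -> (forall j, 0 < an j) -> signal_class an theta ->
      Ex L (fun x => FDP theta (gbs (alpha n) (obs theta x)) +
                   FNP (s n) theta (gbs (alpha n) (obs theta x))) <=
      Lambda n an + ep by exact: (H _ _ _ LP (a_pos n n0) thc).
    by near: n; exact: upper_bound_near.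
  move=> n n0.
  have mg : dmeas (gbs (alpha n) : n.-tuple R -> n.-tuple bool).
    exact: dmeas_gbs (alpha_bounds n n0).
  have fin := max_risk_fin (eps n) (s_bounds n n0) (a_pos n n0) mg.
  by rewrite -[leLHS]fineK// -EFinD lee_fin -lerBlDl le_max lexx orbT.
split=> //; case: up => e1 [e1_0 He1].
pose e n := fine (max_risk (eps n) (a n) (gbs (alpha n))) -
  fine (minimax_risk (eps n) (a n)).
have fins n : (0 < n)%N -> [/\ max_risk (eps n) (a n) (gbs (alpha n)) \is a fin_num,
    minimax_risk (eps n) (a n) \is a fin_num &
    (minimax_risk (eps n) (a n) <= max_risk (eps n) (a n) (gbs (alpha n)))%E].
  move=> n0.
  have mg : dmeas (gbs (alpha n) : n.-tuple R -> n.-tuple bool).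
    exact: dmeas_gbs (alpha_bounds n n0).
  have fin := max_risk_fin (eps n) (s_bounds n n0) (a_pos n n0) mg.
  have le := minimax_risk_le (eps n) (a n) (measurable_gbs (n := n) (alpha_bounds n n0)).
  split => //; apply/fin_real/andP; split.
    by apply: lt_le_trans (minimax_risk_ge0 (eps n) (s_bounds n n0) (a_pos n n0)); exact: ltNyr.
  by apply: le_lt_trans le _; rewrite ltey_eq fin.
exists e; split; last first.
  by move=> n n0; have [f1 f2 _] := fins n n0; rewrite /e EFinB !fineK// [RHS]addeC subeK.
apply/cvgrPdist_le => ep ep0; near=> n.
have n0 : (0 < n)%N by near: n; exists 1%N.
have [f1 f2 le] := fins n n0.
have e0 : 0 <= e n by rewrite subr_ge0 fine_le.
rewrite sub0r normrN ger0_norm// /e.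
have low : Lambda n (a n) - ep / 2 <= fine (minimax_risk (eps n) (a n)).
  rewrite -lee_fin fineK//; apply: le_ereal_inf_tmp => _ [phi mphi <-].
  have LP := noise_law_product (eps_iid n n0).
  have [theta thc H] : exists2 theta, signal_class (a n) theta &
    Lambda n (a n) - ep / 2 <= Ex (noise_law (eps n)) (fun x =>
      FDP theta (phi (obs theta x)) + FNP (s n) theta (phi (obs theta x))).
    suff H : forall (L : probability (n.-tuple R) R) (an : 'I_(s n) -> R) ph,
      product_law L -> (forall j, 0 < an j) -> dmeas ph ->
      exists2 theta, signal_class an theta & Lambda n an - ep / 2 <=
        Ex L (fun x => FDP theta (ph (obs theta x)) +
                       FNP (s n) theta (ph (obs theta x))).
      exact: (H _ _ _ LP (a_pos n n0) (dmeas_procedure mphi)).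
    by near: n; apply: lower_bound_near => //; rewrite divr_gt0.
  apply: (@le_trans _ _ (risk (eps n) (s n) phi theta)).
    by rewrite (riskE (eps n) (s n) theta (dmeas_procedure mphi)) lee_fin.
  by apply: ereal_sup_ubound; exists theta.
have upn : fine (max_risk (eps n) (a n) (gbs (alpha n))) <= Lambda n (a n) + ep / 2.
  rewrite -lee_fin fineK//; apply: le_trans (He1 n n0) _.
  rewrite -EFinD lee_fin lerD2l; near: n.
  by apply: (cvgr_le 0 e1_0); rewrite divr_gt0.
move: low upn; move: (Lambda _ _) (fine _) (fine _) => u v w; lra.
Unshelve. all: by end_near. Qed.
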